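(* Let $F$ be a field of characteristic $2$, let $V$ be an $F$-vector space of dimension $m=4$, let $f:V\times V\to F$ be a non-degenerate alternating bilinear form, and let $L=L(f)$. Then the derived series of $L$ satisfies $$\dim L=10,\ \dim L^{(1)}=6,\ \dim L^{(2)}=5,\ \dim L^{(3)}=1,\ \dim L^{(4)}=0.$$ Here $L^{(3)}=\mathfrak{s}$, $L^{(2)}\cong\mathfrak{h}(2)\cong L/L^{(2)}$ as Lie algebras, and $U=L^{(2)}/L^{(3)}$ is a $4$-dimensional abelian Lie algebra that is irreducible as an $L$-module. More precisely, the action of $L$ on $U$ leaves invariant a non-degenerate alternating bilinear form $g:U\times U\to F$, the kernel of the associated representation $R:L\to L(g)$ is $L^{(2)}$, the corresponding $4$-dimensional faithful representation $S:L/L^{(2)}\to\mathfrak{gl}(U)$ is irreducible, and $S(L/L^{(2)})=R(L)$ is a $5$-dimensional subalgebra of the symplectic Lie algebra $L(g)$ for which the natural module $U$ is irreducible. Moreover, if we identify $L/L^{(2)}$ with $\mathfrak{h}(2)$ (as specified in the context) then $U$ is isomorphic to the $\mathfrak{h}(2)$-module $F[X_1,X_2]/(X_1^2,X_2^2)$ on which $u_i$ acts as $\partial/\partial X_i$, $v_i$ acts as multiplication by $X_i$ $(i=1,2)$, and $z$ acts as the identity.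
   Context: For a bilinear form $\beta$ on a vector space $E$, $L(\beta)=\{x\in\mathfrak{gl}(E)\mid\beta(xv,w)=-\beta(v,xw)\text{ for all }v,w\in E\}$, a Lie subalgebra of $\mathfrak{gl}(E)$ with $[x,y]=xy-yx$. $L^{(1)}=[L,L]$ and $L^{(k+1)}=[L^{(k)},L^{(k)}]$. $L$ acts on $U$ via the bracket. $\mathfrak{s}$ is the space of scalar operators in $\mathfrak{gl}(V)$. $\mathfrak{h}(n)$ is the Heisenberg algebra of dimension $2n+1$; $\mathfrak{h}(2)$ has a basis $u_1,u_2,v_1,v_2,z$ whose only nonzero brackets among basis elements (up to antisymmetry) are $[u_1,v_1]=z=[u_2,v_2]$. Identification $L/L^{(2)}\cong\mathfrak{h}(2)$: choose a basis of $V$ relative to which $f$ has Gram matrix $J=\begin{pmatrix}0&I_2\\ -I_2&0\end{pmatrix}$; in $2\times2$ blocks relative to this basis, let $a=\begin{pmatrix}e_{11}&0\\ 0&e_{11}\end{pmatrix}$, $b_i=\begin{pmatrix}0&e_{ii}\\ 0&0\end{pmatrix}$, $c_i=\begin{pmatrix}0&0\\ e_{ii}&0\end{pmatrix}$ $(i=1,2)$, elements of $L$; then $b_i+L^{(2)}\leftrightarrow u_i$, $c_i+L^{(2)}\leftrightarrow v_i$, $a+L^{(2)}\leftrightarrow z$. *)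

(* Defs.v *)
From HB Require Import structures.
From mathcomp Require Import ssrAC all_boot all_order all_algebra.
From mathcomp Require Import boolp.
From mathcomp Require Import mpoly ring.

Set Implicit Arguments.
Unset Strict Implicit.
Unset Printing Implicit Defensive.

Import GRing.Theory VectorInternalTheory.
Local Open Scope ring_scope.
Local Open Scope quotient_scope.

HB.mixin Record Vector_isLieAlgebra (F : fieldType) (g : Type) of Vector F g := {
  lie : g -> g -> g;
  lie_linearr : forall x, linear (lie x);
  lie_linearl : forall y, linear (lie ^~ y);
  liexx : forall x, lie x x = 0;
  lie_jacobi :
    forall x y z, lie x (lie y z) + lie y (lie z x) + lie z (lie x y) = 0
}.

#[short(type="lieAlgType")]
HB.structure Definition LieAlgebra (F : fieldType) :=
  {g of Vector_isLieAlgebra F g & Vector F g}.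

Notation "[ 'lie' x , y ]" := (lie x y)
  (at level 0, x, y at level 99, format "[ 'lie'  x ,  y ]") : ring_scope.

Section LieTheory.
Variables (F : fieldType) (g : lieAlgType F).
Implicit Types x y z : g.

#[non_forgetful_inheritance]
HB.instance Definition _ x := GRing.isLinear.Build F g g *:%R (lie x) (lie_linearr x).

Lemma lieDl x y z : [lie x + y, z] = [lie x, z] + [lie y, z].
Proof. by have := lie_linearl z 1 x y; rewrite !scale1r. Qed.

Lemma lie0l z : [lie 0, z] = 0.
Proof. by apply: (@addrI _ [lie 0, z]); rewrite -lieDl !addr0. Qed.

Lemma lieZl a x z : [lie a *: x, z] = a *: [lie x, z].
Proof. by have := lie_linearl z a x 0; rewrite lie0l !addr0. Qed.

Lemma lieNl x z : [lie - x, z] = - [lie x, z].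
Proof. by rewrite -scaleN1r lieZl scaleN1r. Qed.

Lemma lieC x y : [lie x, y] = - [lie y, x].
Proof.
apply/eqP; rewrite -addr_eq0.
by have := liexx (x + y); rewrite lieDl !linearD /= !liexx add0r addr0 => ->.
Qed.

End LieTheory.

Section GeneralLinear.
Variables (F : fieldType) (V : vectType F).

Local Notation gl := 'End(V).

Definition gl_lie (x y : gl) : gl := ((x \o y) - (y \o x))%VF.

Lemma gl_lieE x y v : gl_lie x y v = x (y v) - y (x v).
Proof. by rewrite /gl_lie add_lfunE opp_lfunE !comp_lfunE. Qed.

Fact gl_lie_linearr x : linear (gl_lie x).
Proof.
move=> a y z; apply/lfunP=> v; rewrite [RHS]add_lfunE [in RHS]scale_lfunE !gl_lieE.
by rewrite !add_lfunE !scale_lfunE linearP scalerBr opprD addrACA.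
Qed.

Fact gl_lie_linearl y : linear (gl_lie ^~ y).
Proof.
move=> a x z; apply/lfunP=> v; rewrite [RHS]add_lfunE [in RHS]scale_lfunE !gl_lieE.
by rewrite !add_lfunE !scale_lfunE linearP scalerBr opprD addrACA.
Qed.

Fact gl_liexx x : gl_lie x x = 0.
Proof. exact: subrr. Qed.

Fact gl_jacobi x y z :
  gl_lie x (gl_lie y z) + gl_lie y (gl_lie z x) + gl_lie z (gl_lie x y) = 0.
Proof.
apply/lfunP=> v; have D (a b : gl) : (a + b) v = a v + b v := add_lfunE a b v.
rewrite D (D (gl_lie _ _)) !gl_lieE !linearB /= zero_lfunE !opprK.
rewrite [LHS](AC (2*2*(2*2)*(2*2))
  ((1*11)*(8*2)*(4*10)*(5*3)*(12*6)*(9*7))).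
by rewrite /= !subrr !addr0.
Qed.

HB.instance Definition _ := Vector_isLieAlgebra.Build F gl
  gl_lie_linearr gl_lie_linearl gl_liexx gl_jacobi.

End GeneralLinear.

Record lieSubalg (F : fieldType) (g : lieAlgType F) := LieSubalg {
  subalg_vspace :> {vspace g};
  subalg_closed :
    forall x y, x \in subalg_vspace -> y \in subalg_vspace ->
    [lie x, y] \in subalg_vspace
}.

Record lieIdeal (F : fieldType) (g : lieAlgType F) := LieIdeal {
  ideal_vspace : {vspace g};
  ideal_closed : forall x y, y \in ideal_vspace -> [lie x, y] \in ideal_vspace
}.

Coercion ideal_subalg F g (I : @lieIdeal F g) : lieSubalg g :=
  @LieSubalg F g (ideal_vspace I) (fun x y _ Iy => ideal_closed x Iy).

Section SubalgebraType.
Variables (F : fieldType) (g : lieAlgType F) (A : lieSubalg g).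

Definition lie_sub : Type := subvs_of A.
HB.instance Definition _ := Vector.on lie_sub.

Definition sub_val (x : lie_sub) : g := vsval x.
Definition to_sub (x : g) : lie_sub := vsproj A x.

Fact sub_val_linear : linear sub_val. Proof. by []. Qed.
HB.instance Definition _ :=
  GRing.isLinear.Build F lie_sub g *:%R sub_val sub_val_linear.

Fact to_sub_linear : linear to_sub. Proof. exact: linearP. Qed.
HB.instance Definition _ :=
  GRing.isLinear.Build F g lie_sub *:%R to_sub to_sub_linear.

Lemma sub_val_in x : sub_val x \in A. Proof. exact: subvsP. Qed.

Lemma sub_val_inj : injective sub_val. Proof. exact: val_inj. Qed.

Lemma to_subK x : x \in A -> sub_val (to_sub x) = x.
Proof. exact: vsprojK. Qed.

Lemma sub_valK : cancel sub_val to_sub. Proof. exact: vsvalK. Qed.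

Definition sub_lie (x y : lie_sub) : lie_sub := to_sub [lie sub_val x, sub_val y].

Lemma sub_val_lie x y : sub_val (sub_lie x y) = [lie sub_val x, sub_val y].
Proof. by rewrite to_subK // subalg_closed ?sub_val_in. Qed.

Fact sub_lie_linearr x : linear (sub_lie x).
Proof. by move=> a y z; apply: sub_val_inj; rewrite /sub_lie !linearP. Qed.

Fact sub_lie_linearl y : linear (sub_lie ^~ y).
Proof.
move=> a x z; apply: sub_val_inj.
by rewrite /sub_lie linearP /= lieDl lieZl linearP.
Qed.

Fact sub_liexx x : sub_lie x x = 0.
Proof. by apply: sub_val_inj; rewrite sub_val_lie liexx linear0. Qed.

Fact sub_jacobi x y z :
  sub_lie x (sub_lie y z) + sub_lie y (sub_lie z x) + sub_lie z (sub_lie x y)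
  = 0.
Proof.
apply: sub_val_inj.
by rewrite !linearD /= !sub_val_lie lie_jacobi.
Qed.

HB.instance Definition _ := Vector_isLieAlgebra.Build F lie_sub
  sub_lie_linearr sub_lie_linearl sub_liexx sub_jacobi.

Definition sub_incl : 'Hom(lie_sub, g) := linfun sub_val.

End SubalgebraType.
Arguments to_sub {F g} A x.

Record submodule (F : fieldType) (M : lmodType F) := Submodule {
  submod_pred :> {pred M};
  submod_predP : submod_closed submod_pred
}.

HB.instance Definition _ F M (W : @submodule F M) :=
  GRing.isSubmodClosed.Build F M (submod_pred W) (submod_predP W).

Section ModuleQuotient.
Variables (F : fieldType) (M : lmodType F) (W : submodule M).
Local Notation WZ := [the zmodClosed M of submod_pred W].

Definition lquot : Type := {ideal_quot WZ}.
HB.instance Definition _ := GRing.Zmodule.on lquot.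

Definition lproj (x : M) : lquot := \pi_{ideal_quot WZ} x.
Definition lrepr (q : lquot) : M := repr q.

Lemma lreprK : cancel lrepr lproj. Proof. exact: reprK. Qed.

Lemma lproj_eq x y : (lproj x == lproj y) = (x - y \in W).
Proof. by rewrite Quotient.idealrBE. Qed.

Lemma lreprE x : lrepr (lproj x) - x \in W.
Proof. by rewrite -lproj_eq lreprK. Qed.

Fact lprojD x y : lproj (x + y) = lproj x + lproj y.
Proof. by rewrite /lproj !piE. Qed.

Definition lquot_scale a (q : lquot) : lquot := lproj (a *: lrepr q).

Lemma lquot_scaleE a x : lquot_scale a (lproj x) = lproj (a *: x).
Proof.
by apply/eqP; rewrite lproj_eq -scalerBr rpredZ // lreprE.
Qed.

Fact lquot_scaleA a b q :
  lquot_scale a (lquot_scale b q) = lquot_scale (a * b) q.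
Proof. by rewrite -[q]lreprK !lquot_scaleE scalerA. Qed.

Fact lquot_scale1 : left_id 1 lquot_scale.
Proof. by move=> q; rewrite -[q]lreprK lquot_scaleE scale1r. Qed.

Fact lquot_scaleDr : right_distributive lquot_scale +%R.
Proof.
move=> a p q; rewrite -[p]lreprK -[q]lreprK.
by rewrite -lprojD !lquot_scaleE -lprojD scalerDr.
Qed.

Fact lquot_scaleDl q : {morph lquot_scale^~ q : a b / a + b}.
Proof.
by move=> a b; rewrite -[q]lreprK !lquot_scaleE -lprojD scalerDl.
Qed.

HB.instance Definition _ := GRing.Zmodule_isLmodule.Build F lquot
  lquot_scaleA lquot_scale1 lquot_scaleDr lquot_scaleDl.

Fact lproj_linear : linear lproj.
Proof. by move=> a x y; rewrite lprojD -lquot_scaleE. Qed.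
HB.instance Definition _ :=
  GRing.isLinear.Build F M lquot *:%R lproj lproj_linear.

End ModuleQuotient.

Section VectorQuotient.
Variables (F : fieldType) (V : vectType F) (W : {vspace V}).

Definition vspace_submodule : submodule V := Submodule (memv_submod_closed W).

Definition vquot : Type := lquot vspace_submodule.
HB.instance Definition _ := GRing.Lmodule.on vquot.

Definition vproj : V -> vquot := @lproj F V vspace_submodule.
Definition vrepr : vquot -> V := @lrepr F V vspace_submodule.

Fact vproj_linear : linear vproj. Proof. exact: lproj_linear. Qed.
HB.instance Definition _ :=
  GRing.isLinear.Build F V vquot *:%R vproj vproj_linear.

Lemma vreprK : cancel vrepr vproj. Proof. exact: lreprK. Qed.

Lemma vproj_eq x y : (vproj x == vproj y) = (x - y \in W).
Proof. exact: lproj_eq. Qed.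

Lemma vproj_eq0 x : (vproj x == 0) = (x \in W).
Proof. by rewrite -(linear0 vproj) vproj_eq subr0. Qed.

Lemma vreprE x : vrepr (vproj x) - x \in W.
Proof. exact: lreprE. Qed.

Let compl_coord (x : V) : subvs_of W^C := vsproj _ (daddv_pi W^C W x).

Let compl_coordW x y : x - y \in W -> compl_coord x = compl_coord y.
Proof.
move=> Wxy; apply/eqP; rewrite -subr_eq0 -!linearB /=.
suff -> : daddv_pi W^C W (x - y) = 0 by rewrite linear0.
have cW : (W^C :&: W = 0)%VS by rewrite capvC capv_compl.
have WW : (W :&: W^C = 0)%VS by rewrite capv_compl.
have := @daddv_pi_add _ _ (W^C)%VS W (x - y) cW.
rewrite addvC addv_complf memvf => /(_ isT).
by rewrite (daddv_pi_id WW Wxy) => /(canRL (addrK _)) ->; rewrite subrr.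
Qed.

Fact vquot_vect_iso : Vector.axiom (dim (subvs_of W^C)) vquot.
Proof.
pose h (q : vquot) : 'rV[F]_(dim (subvs_of W^C)) := v2r (compl_coord (vrepr q)).
exists h.
  move=> a p q; rewrite /h -linearP; congr v2r.
  transitivity (compl_coord (a *: vrepr p + vrepr q)).
    apply: compl_coordW; apply/eqP; move: (vproj_eq0 (vrepr (a *: p + q) - (a *: vrepr p + vrepr q))).
    by rewrite linearB linearP /= !vreprK subrr eqxx => <-.
  by rewrite /compl_coord !linearP.
exists (fun r => vproj (vsval (r2v r))) => [q | r].
  rewrite /h v2rK -{2}[q]vreprK; apply/eqP; rewrite vproj_eq.
  have cW : (W^C :&: W = 0)%VS by rewrite capvC capv_compl.
  rewrite vsprojK ?memv_pi // -memvN opprB.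
  have := @daddv_pi_add _ _ (W^C)%VS W (vrepr q) cW.
  rewrite addvC addv_complf memvf => /(_ isT) eq_q.
  by rewrite -{1}eq_q addrAC subrr add0r memv_pi.
apply: (canLR r2vK); rewrite -[RHS]vsvalK -/(compl_coord _).
rewrite (@compl_coordW _ (vsval (r2v r))) ?vreprE //.
congr vsproj; apply: daddv_pi_id; first by rewrite capvC capv_compl.
exact: subvsP.
Qed.

HB.instance Definition _ := Lmodule_hasFinDim.Build F vquot vquot_vect_iso.

End VectorQuotient.

Section LieQuotient.
Variables (F : fieldType) (g : lieAlgType F) (I : lieIdeal g).

Definition lie_quot : Type := vquot I.
HB.instance Definition _ := Vector.on lie_quot.

Definition lie_proj : g -> lie_quot := @vproj F g I.
Definition lie_repr : lie_quot -> g := @vrepr F g I.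

Fact lie_proj_linear : linear lie_proj. Proof. exact: vproj_linear. Qed.
HB.instance Definition _ :=
  GRing.isLinear.Build F g lie_quot *:%R lie_proj lie_proj_linear.

Lemma lie_reprK : cancel lie_repr lie_proj. Proof. exact: vreprK. Qed.

Lemma lie_proj_eq x y : (lie_proj x == lie_proj y) = (x - y \in I).
Proof. exact: vproj_eq. Qed.

Lemma lie_reprE x : lie_repr (lie_proj x) - x \in I.
Proof. exact: vreprE. Qed.

Definition quot_lie (p q : lie_quot) : lie_quot :=
  lie_proj [lie lie_repr p, lie_repr q].

Lemma quot_lieE x y : quot_lie (lie_proj x) (lie_proj y) = lie_proj [lie x, y].
Proof.
have Ix := lie_reprE x; have Iy := lie_reprE y.
apply/eqP; rewrite lie_proj_eq.
set x' := lie_repr _ in Ix *; set y' := lie_repr _ in Iy *.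
have -> : [lie x', y'] - [lie x, y] = [lie x, y' - y] - [lie y', x' - x].
  rewrite (linearB (lie x)) (linearB (lie y')) /= (lieC y' x') (lieC y' x).
  by rewrite -opprD opprK (AC (2*2) ((1*4)*(3*2))) /= subrr add0r.
by apply: rpredB; apply: ideal_closed.
Qed.

Fact quot_lie_linearr p : linear (quot_lie p).
Proof.
move=> a q r; rewrite -[p]lie_reprK -[q]lie_reprK -[r]lie_reprK.
by rewrite -linearP !quot_lieE linearP linearP.
Qed.

Fact quot_lie_linearl q : linear (quot_lie ^~ q).
Proof.
move=> a p r; rewrite -[p]lie_reprK -[q]lie_reprK -[r]lie_reprK.
by rewrite -linearP !quot_lieE lieDl lieZl linearP.
Qed.

Fact quot_liexx p : quot_lie p p = 0.
Proof. by rewrite -[p]lie_reprK quot_lieE liexx linear0. Qed.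

Fact quot_jacobi p q r :
  quot_lie p (quot_lie q r) + quot_lie q (quot_lie r p) +
  quot_lie r (quot_lie p q) = 0.
Proof.
rewrite -[p]lie_reprK -[q]lie_reprK -[r]lie_reprK !quot_lieE.
by rewrite -!linearD lie_jacobi linear0.
Qed.

HB.instance Definition _ := Vector_isLieAlgebra.Build F lie_quot
  quot_lie_linearr quot_lie_linearl quot_liexx quot_jacobi.

End LieQuotient.
Arguments lie_proj {F g} I x.

Section DerivedSeries.
Variables (F : fieldType) (g : lieAlgType F).
Implicit Types A B C : {vspace g}.

(* By bilinearity, bases suffice to span [A, B]: see memv_lie and lie_prodvP. *)
Definition lie_prodv A B : {vspace g} :=
  <<[seq [lie x, y] | x <- vbasis A, y <- vbasis B]>>%VS.

Lemma memv_lie A B x y : x \in A -> y \in B -> [lie x, y] \in lie_prodv A B.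
Proof.
move=> Ax By; rewrite (coord_vbasis Ax) (coord_vbasis By).
rewrite linear_sum memv_suml // => j _ /=; rewrite lieC rpredN.
rewrite linear_sum memv_suml // => i _ /=; rewrite lieC rpredN linearZ /= lieZl.
by rewrite !memvZ // memv_span //; apply/allpairsP;
   exists ((vbasis A)`_i, (vbasis B)`_j); rewrite !mem_nth ?size_tuple.
Qed.

Lemma lie_prodvP A B C :
  reflect (forall x y, x \in A -> y \in B -> [lie x, y] \in C)
          (lie_prodv A B <= C)%VS.
Proof.
apply: (iffP idP) => [/subvP sABC x y Ax By | sABC].
  exact/sABC/memv_lie.
apply/span_subvP=> _ /allpairsP[[x y] /= [Ax By ->]].
by apply: sABC; apply: vbasis_mem.
Qed.

Fact lie_prodv_ideal (I J : lieIdeal g) :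
  forall x y, y \in lie_prodv I J -> [lie x, y] \in lie_prodv I J.
Proof.
move=> x y IJy.
suff /subvP/(_ y IJy) : (lie_prodv I J <= linfun (lie x) @^-1: lie_prodv I J)%VS.
  by rewrite -memv_preim lfunE.
apply/lie_prodvP=> u v Iu Jv; rewrite -memv_preim lfunE /=.
have /eqP := lie_jacobi x u v; rewrite -addrA addr_eq0 => /eqP ->.
rewrite rpredN rpredD //; last by rewrite lieC rpredN memv_lie ?ideal_closed.
by apply: memv_lie => //; rewrite lieC rpredN ideal_closed.
Qed.

Definition lie_full : lieIdeal g := @LieIdeal F g fullv (fun x y _ => memvf _).

Fixpoint derived k : lieIdeal g :=
  if k is k'.+1 then LieIdeal (@lie_prodv_ideal (derived k') (derived k'))
  else lie_full.

End DerivedSeries.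

Section Morphisms.
Variables (F : fieldType) (g h : lieAlgType F).

Definition lie_hom (phi : 'Hom(g, h)) : Prop :=
  forall x y, phi [lie x, y] = [lie phi x, phi y].

Definition lie_iso (phi : 'Hom(g, h)) : Prop := lie_hom phi /\ bijective phi.

Definition lie_isomorphic : Prop := exists phi : 'Hom(g, h), lie_iso phi.

End Morphisms.

Definition lie_abelian (F : fieldType) (g : lieAlgType F) : Prop :=
  forall x y : g, [lie x, y] = 0.

Section Modules.
Variables (F : fieldType) (g : lieAlgType F).

Definition lie_module (M : lmodType F) (act : g -> M -> M) : Prop :=
  [/\ forall x, linear (act x), forall m, linear (act ^~ m)
    & forall x y m, act [lie x, y] m = act x (act y m) - act y (act x m)].

Definition module_isomorphic (M N : lmodType F)
    (actM : g -> M -> M) (actN : g -> N -> N) : Prop :=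
  exists phi : {linear M -> N},
    bijective phi /\ forall x m, phi (actM x m) = actN x (phi m).

Definition irreducible_rep (U : vectType F) (rho : 'Hom(g, 'End(U))) : Prop :=
  {:U}%VS <> 0%VS /\
  forall W : {vspace U}, (forall x, (rho x @: W <= W)%VS) ->
    W = 0%VS \/ W = fullv.

End Modules.

Section SectionModule.
Variables (F : fieldType) (g : lieAlgType F).

Fact restrict_ideal_closed (A : lieSubalg g) (J : lieIdeal g) :
  forall x y : lie_sub A, y \in (sub_incl A @^-1: J)%VS ->
    [lie x, y] \in (sub_incl A @^-1: J)%VS.
Proof.
move=> x y; rewrite -!memv_preim !lfunE /= => Jy.
by rewrite sub_val_lie ideal_closed.
Qed.

Definition restrict_ideal (A : lieSubalg g) (J : lieIdeal g) :
  lieIdeal (lie_sub A) := LieIdeal (@restrict_ideal_closed A J).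

Variables I J : lieIdeal g.

(* The quotient of the Lie algebra I by its ideal made of the elements lying
   in J; this is I / J when J is contained in I. *)
Definition lie_section : lieAlgType F := lie_quot (restrict_ideal I J).

Definition section_act (x : g) (q : lie_section) : lie_section :=
  lie_proj (restrict_ideal I J) (to_sub I [lie x, sub_val (lie_repr q)]).

Lemma section_actE x (y : lie_sub I) :
  section_act x (lie_proj (restrict_ideal I J) y) =
  lie_proj (restrict_ideal I J) (to_sub I [lie x, sub_val y]).
Proof.
apply/eqP; rewrite lie_proj_eq -linearB -linearB /=.
rewrite -memv_preim lfunE /= -linearB to_subK; last first.
  by rewrite ideal_closed ?sub_val_in.
by apply: ideal_closed; have := lie_reprE (restrict_ideal I J) y; rewrite -memv_preim lfunE.
Qed.

Fact section_act_linear x : linear (section_act x).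
Proof.
move=> a p q; rewrite -[p]lie_reprK -[q]lie_reprK -linearP !section_actE.
by rewrite !linearP.
Qed.
HB.instance Definition _ x := GRing.isLinear.Build F lie_section lie_section
  *:%R (section_act x) (section_act_linear x).

Definition section_op (x : g) : 'End(lie_section) := linfun (section_act x).

Fact section_op_linear : linear section_op.
Proof.
move=> a x y; apply/lfunP=> q; rewrite [RHS]add_lfunE [in RHS]scale_lfunE.
rewrite !lfunE /= -[q]lie_reprK !section_actE lieDl lieZl.
by rewrite !linearP.
Qed.
HB.instance Definition _ := GRing.isLinear.Build F g 'End(lie_section)
  *:%R section_op section_op_linear.

Definition section_rep : 'Hom(g, 'End(lie_section)) := linfun section_op.

Lemma section_repE x q : section_rep x q = section_act x q.
Proof. by rewrite lfunE /= lfunE. Qed.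

Lemma section_rep_hom : lie_hom section_rep.
Proof.
move=> x y; apply/lfunP=> q; rewrite gl_lieE !section_repE -[q]lie_reprK.
set z := lie_repr q; rewrite !section_actE -linearB -linearB /=.
rewrite !to_subK ?ideal_closed ?sub_val_in //; congr (lie_proj _ (to_sub _ _)).
have /eqP := lie_jacobi x y (sub_val z); rewrite addr_eq0 => /eqP eJ.
by rewrite (lieC _ (sub_val z)) -eJ (lieC (sub_val z)) linearN.
Qed.

End SectionModule.

Section Forms.
Variables (F : fieldType) (V : vectType F).
Implicit Type beta : {biscalar V}.

Definition alternating_form beta : Prop := forall v, beta v v = 0.

Definition nondegenerate_form beta : Prop :=
  forall v, (forall w, beta v w = 0) -> v = 0.

(* The defect vanishes exactly on L(beta): see form_lieP. *)
Definition form_defect beta (x : 'End(V)) : 'M[F]_(\dim {:V}) :=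
  \matrix_(i, j) (beta (x (vbasis fullv)`_i) (vbasis fullv)`_j
                  + beta (vbasis fullv)`_i (x (vbasis fullv)`_j)).

Fact form_defect_linear beta : linear (form_defect beta).
Proof.
move=> a x y; apply/matrixP=> i j; rewrite !mxE !add_lfunE !scale_lfunE.
by rewrite linearPl linearPr /= mulrDr addrACA.
Qed.
HB.instance Definition _ beta := GRing.isLinear.Build F 'End(V) _ *:%R
  (form_defect beta) (form_defect_linear beta).

Definition form_lie_vspace beta : {vspace 'End(V)} :=
  lker (linfun (form_defect beta)).

Lemma form_lie_vspaceP beta (x : 'End(V)) :
  reflect (forall v w, beta (x v) w = - beta v (x w)) (x \in form_lie_vspace beta).
Proof.
rewrite memv_ker lfunE /=; apply: (iffP eqP) => [x0 v w | xP]; last first.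
  by apply/matrixP=> i j; rewrite !mxE xP addNr.
have xe (i j : 'I_(\dim {:V})) : beta (x (vbasis fullv)`_i) (vbasis fullv)`_j =
              - beta (vbasis fullv)`_i (x (vbasis fullv)`_j).
  by have /matrixP/(_ i j) := x0; rewrite !mxE => /eqP; rewrite addr_eq0 => /eqP.
have xv (j : 'I_(\dim {:V})) : beta (x v) (vbasis fullv)`_j = - beta v (x (vbasis fullv)`_j).
  rewrite (coord_vbasis (memvf v)) linear_sum !linear_sumlz -sumrN.
  by apply: eq_bigr => i _; rewrite linearZ /= !linearZl_LR /= xe mulrN.
rewrite (coord_vbasis (memvf w)) (linear_sum x) !linear_sumr -sumrN.
by apply: eq_bigr => j _; rewrite (linearZ_LR x) /= !linearZr_LR /= xv mulrN.
Qed.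

End Forms.

Section FormAlgebra.
Variables (F : fieldType) (V : vectType F) (beta : {biscalar V}).

Fact form_lie_closed (x y : 'End(V)) :
  x \in form_lie_vspace beta -> y \in form_lie_vspace beta ->
  [lie x, y] \in form_lie_vspace beta.
Proof.
move=> /form_lie_vspaceP xP /form_lie_vspaceP yP; apply/form_lie_vspaceP=> v w.
rewrite !gl_lieE linearBl linearBr /= !xP !yP !xP.
by rewrite !opprK opprB.
Qed.

Definition form_lie : lieSubalg 'End(V) := LieSubalg form_lie_closed.

Lemma form_lieP (x : 'End(V)) :
  reflect (forall v w, beta (x v) w = - beta v (x w)) (x \in form_lie).
Proof. exact: form_lie_vspaceP. Qed.

End FormAlgebra.

Section MatrixEndomorphism.
Variables (F : fieldType) (V : vectType F) (n : nat) (e : n.-tuple V).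

(* Matrices act on columns of coordinates relative to e, so that composition
   corresponds to the matrix product; hommx in vector.v acts on rows instead. *)
Definition mx_act (M : 'M[F]_n) (v : V) : V :=
  \sum_i (\sum_j M i j * coord e j v) *: e`_i.

Fact mx_act_linear M : linear (mx_act M).
Proof.
move=> a v w; rewrite /mx_act scaler_sumr -big_split; apply: eq_bigr => i _.
rewrite /= scalerA -scalerDl mulr_sumr -big_split; congr (_ *: _).
by apply: eq_bigr => j _; rewrite linearP /= mulrDr mulrCA.
Qed.
HB.instance Definition _ M :=
  GRing.isLinear.Build F V V *:%R (mx_act M) (mx_act_linear M).

Definition mx_end (M : 'M[F]_n) : 'End(V) := linfun (mx_act M).

Lemma mx_endE M (j : 'I_n) : basis_of {:V} e ->
  mx_end M e`_j = \sum_i M i j *: e`_i.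
Proof.
move=> /basis_free free_e; rewrite lfunE /=; apply: eq_bigr => i _.
rewrite (bigD1 j) //= coord_free // eqxx mulr1 big1 ?addr0 // => k k_j.
by rewrite coord_free // eq_sym (negPf k_j) mulr0.
Qed.

End MatrixEndomorphism.

Section SymplecticBasis.
Variables (F : fieldType) (V : vectType F) (beta : {biscalar V}).

Definition symplectic_mx n : 'M[F]_(n + n) := block_mx 0 1%:M (- 1%:M) 0.

Definition symplectic_basis n (e : (n + n).-tuple V) : Prop :=
  basis_of {:V} e /\
  forall i j : 'I_(n + n), beta e`_i e`_j = symplectic_mx n i j.

End SymplecticBasis.

Section Heisenberg.
Variables (F : fieldType) (n : nat).

(* The triple (a, b, c) stands for sum_i a_i u_i + sum_i b_i v_i + c z. *)
Definition heisenberg : Type := ('rV[F]_n * 'rV[F]_n * F^o)%type.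
HB.instance Definition _ := Vector.on heisenberg.

Definition heis_u (i : 'I_n) : heisenberg := (delta_mx 0 i, 0, 0).
Definition heis_v (i : 'I_n) : heisenberg := (0, delta_mx 0 i, 0).
Definition heis_z : heisenberg := (0, 0, 1).

Definition heis_lie (x y : heisenberg) : heisenberg :=
  (0, 0, \sum_i (x.1.1 0 i * y.1.2 0 i - y.1.1 0 i * x.1.2 0 i)).

Fact heis_lie_linearr x : linear (heis_lie x).
Proof.
move=> a y z; congr (_, _, _); rewrite /= ?scaler0 ?addr0 //.
rewrite scaler_sumr -big_split; apply: eq_bigr => i _ /=.
by rewrite !mxE /GRing.scale /=; ring.
Qed.

Fact heis_lie_linearl y : linear (heis_lie ^~ y).
Proof.
move=> a x z; congr (_, _, _); rewrite /= ?scaler0 ?addr0 //.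
rewrite scaler_sumr -big_split; apply: eq_bigr => i _ /=.
by rewrite !mxE /GRing.scale /=; ring.
Qed.

Fact heis_liexx x : heis_lie x x = 0.
Proof. by congr (_, _, _); rewrite big1 // => i _; rewrite subrr. Qed.

Fact heis_lie_nil x y z : heis_lie x (heis_lie y z) = 0.
Proof.
congr (_, _, _); rewrite big1 // => i _.
by rewrite !mxE mulr0 mul0r subrr.
Qed.

Fact heis_jacobi x y z :
  heis_lie x (heis_lie y z) + heis_lie y (heis_lie z x) +
  heis_lie z (heis_lie x y) = 0.
Proof. by rewrite !heis_lie_nil !addr0. Qed.

HB.instance Definition _ := Vector_isLieAlgebra.Build F heisenberg
  heis_lie_linearr heis_lie_linearl heis_liexx heis_jacobi.

End Heisenberg.
Arguments heis_u {F n} i.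
Arguments heis_v {F n} i.
Arguments heis_z {F n}.

Section PolynomialModule.
Variables (F : fieldType) (n : nat).
Local Notation P := {mpoly F[n]}.

Definition squares_ideal : {pred P} :=
  fun p => `[< exists c : 'I_n -> P, p = \sum_i c i * 'X_i ^+ 2 >].

Fact squares_ideal_submod : submod_closed squares_ideal.
Proof.
split=> [|a p q /asboolP[c ->] /asboolP[d ->]]; apply/asboolP.
  by exists (fun=> 0); rewrite big1 // => i _; rewrite mul0r.
exists (fun i => a *: c i + d i); rewrite scaler_sumr -big_split.
by apply: eq_bigr => i _; rewrite mulrDl scalerAl.
Qed.

Definition squares_submodule : submodule P := Submodule squares_ideal_submod.

Definition trunc_poly : lmodType F := lquot squares_submodule.

Definition trunc_proj : P -> trunc_poly := @lproj F P squares_submodule.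

Fact trunc_proj_linear : linear trunc_proj. Proof. exact: lproj_linear. Qed.
HB.instance Definition _ :=
  GRing.isLinear.Build F P trunc_poly *:%R trunc_proj trunc_proj_linear.

Definition trunc_repr : trunc_poly -> P := @lrepr F P squares_submodule.

Lemma trunc_reprK : cancel trunc_repr trunc_proj. Proof. exact: lreprK. Qed.

Definition poly_act (x : heisenberg F n) (p : P) : P :=
  \sum_i x.1.1 0 i *: p^`M(i) + \sum_i x.1.2 0 i *: ('X_i * p) + x.2 *: p.

(* Acting on the chosen representative is only meaningful when squares_ideal is
   stable, which needs characteristic 2: see trunc_actE and trunc_module. *)
Definition trunc_act (x : heisenberg F n) (q : trunc_poly) : trunc_poly :=
  trunc_proj (poly_act x (trunc_repr q)).

Let D (x : heisenberg F n) (p : P) : P := \sum_i x.1.1 0 i *: p^`M(i).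
Let m (x : heisenberg F n) : P := \sum_i x.1.2 0 i *: 'X_i.

Let poly_actE x p : poly_act x p = D x p + m x * p + x.2 *: p.
Proof.
rewrite /poly_act /m mulr_suml; congr (_ + _ + _).
by apply: eq_bigr => i _; rewrite scalerAl.
Qed.

Let D_linear x : linear (D x).
Proof.
move=> a p q; rewrite /D scaler_sumr -big_split; apply: eq_bigr => i _ /=.
by rewrite linearP /= scalerDr !scalerA mulrC.
Qed.

Let DD x p q : D x (p + q) = D x p + D x q.
Proof. by have := D_linear x 1 p q; rewrite !scale1r. Qed.

Let D0 x : D x 0 = 0.
Proof. by apply: (addrI (D x 0)); rewrite -DD !addr0. Qed.

Let DZ x a p : D x (a *: p) = a *: D x p.
Proof.
by have := D_linear x a p 0; rewrite D0 !addr0.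
Qed.

Let DM x p q : D x (p * q) = D x p * q + p * D x q.
Proof.
rewrite /D mulr_suml mulr_sumr -big_split; apply: eq_bigr => i _ /=.
by rewrite mderivM scalerDr scalerAl scalerAr.
Qed.

Let DDE x y p :
  D x (D y p) = \sum_i \sum_j (x.1.1 0 i * y.1.1 0 j) *: p^`M(j)^`M(i).
Proof.
rewrite {1}/D; apply: eq_bigr => i _; rewrite (linear_sum (mderiv i)) scaler_sumr.
by apply: eq_bigr => j _; rewrite /= mderivZ scalerA.
Qed.

Let DC x y p : D x (D y p) = D y (D x p).
Proof.
rewrite !DDE exchange_big; apply: eq_bigr => i _; apply: eq_bigr => j _.
by rewrite mderiv_comm mulrC.
Qed.

Let mderivXU (i j : 'I_n) : ('X_j : P)^`M(i) = (i == j)%:R.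
Proof.
rewrite mderivX mnm1E eq_sym; case: eqP => [->|_]; last by rewrite scale0r.
by rewrite scale1r -[U_(j)%MM in X in (X - _)%MM]add0m addmK mpolyX0.
Qed.

Let Dm x y : D x (m y) = (\sum_i x.1.1 0 i * y.1.2 0 i) *: 1.
Proof.
rewrite /D scaler_suml; apply: eq_bigr => i _.
rewrite (linear_sum (mderiv i)) (bigD1 i) //= big1 => [|j j_i] /=; last first.
  by rewrite mderivZ mderivXU eq_sym (negPf j_i) scaler0.
by rewrite addr0 mderivZ mderivXU eqxx scalerA.
Qed.

Fact poly_act_linear x : linear (poly_act x).
Proof.
move=> a p q; rewrite !poly_actE D_linear mulrDr -scalerAr !scalerDr !scalerA.
by rewrite [x.2 * a]mulrC [LHS](AC (2*2*2) ((1*3*5)*(2*4*6))).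
Qed.

HB.instance Definition _ x :=
  GRing.isLinear.Build F P P *:%R (poly_act x) (poly_act_linear x).

Fact poly_act_linearl p : linear (poly_act ^~ p).
Proof.
move=> a x y; rewrite /poly_act /= !scalerDr !scaler_sumr.
rewrite [RHS](AC (3*3) ((1*4)*(2*5)*(3*6))) /= scalerDl scalerA.
by congr (_ + _ + _); rewrite -big_split; apply: eq_bigr => i _;
  rewrite !mxE scalerDl scalerA.
Qed.

Fact poly_act_lie x y p :
  poly_act [lie x, y] p = poly_act x (poly_act y p) - poly_act y (poly_act x p).
Proof.
have -> : poly_act [lie x, y] p = D x (m y) * p - D y (m x) * p.
  rewrite !Dm -!scalerAl !mul1r -scalerBl /poly_act /=.
  rewrite big1 => [|i _]; last by rewrite mxE scale0r.
  rewrite big1 => [|i _]; last by rewrite mxE scale0r.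
  by rewrite !add0r -sumrB.
by rewrite !poly_actE !DD !DZ !DM (DC y x) -!mul_mpolyC; ring.
Qed.

Hypothesis char2 : 2%N \in [pchar F].

Let squares_act x p : p \in squares_ideal -> poly_act x p \in squares_ideal.
Proof.
move=> /asboolP[c ->]; apply/asboolP; exists (fun i => poly_act x (c i)).
rewrite poly_actE /D.
have DX i : D x ('X_i ^+ 2) = 0.
  by rewrite expr2 DM mulrC -mulr2n -scaler_nat (pcharf0 char2) scale0r.
have DS (r : seq 'I_n) :
  D x (\sum_(i <- r) c i * 'X_i ^+ 2) = \sum_(i <- r) D x (c i) * 'X_i ^+ 2.
  elim: r => [|i r IHr]; last by rewrite !big_cons DD IHr DM DX mulr0 addr0.
  by rewrite !big_nil D0.
rewrite -/(D x _) DS mulr_sumr scaler_sumr -!big_split; apply: eq_bigr => i _.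
by rewrite /= poly_actE !mulrDl mulrA scalerAl.
Qed.

Lemma trunc_actE x p : trunc_act x (trunc_proj p) = trunc_proj (poly_act x p).
Proof.
apply/eqP; rewrite lproj_eq -linearB.
by apply: squares_act; apply: lreprE.
Qed.

Lemma trunc_module : lie_module trunc_act.
Proof.
split=> [x a p q | q a x y | x y q].
- rewrite -[p]trunc_reprK -[q]trunc_reprK -linearP !trunc_actE.
  by rewrite !linearP.
- by rewrite /trunc_act poly_act_linearl linearP.
rewrite -[q]trunc_reprK !trunc_actE poly_act_lie.
by rewrite linearB.
Qed.

End PolynomialModule.

(* Main.v *)
(**
In a symplectic basis, with signs irrelevant in characteristic 2, the algebra
L consists of the block matrices [[A, B], [C, A^T]] with B and C symmetric.
Writing A = [[s + a, p], [q, s]], B = [[b1, r], [r, b2]] and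
C = [[c1, t], [t, c2]] gives ten coordinates s, p, q, r, t, a, b1, b2, c1, c2
in which the bracket is an explicit quadratic map, and the derived algebras
are the spans of the first 10, 6, 5, 1 and 0 basis vectors.  The coordinates
(p, q, r, t) describe U, (a, b1, b2, c1, c2) describe L / L^(2), and U becomes
F[X_1, X_2] / (X_1^2, X_2^2) by sending the vectors of r, q, p and t to 1, X_1,
X_2 and X_1 X_2.  U is irreducible because b1 and b2, acting as derivations,
lower any nonzero element to a nonzero constant, from which c1 and c2 generate
everything; the invariant form is the bracket L^(2) x L^(2) -> L^(3) = F.
*)
From HB Require Import structures.
Require Import Defs.
From mathcomp Require Import all_boot all_order all_algebra.
From mathcomp Require Import boolp mpoly ring.

Set Implicit Arguments.
Unset Strict Implicit.
Unset Printing Implicit Defensive.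

Import GRing.Theory.
Local Open Scope ring_scope.

(** Runs through the values 0 to 9 of an index; a bound on it in the goal closes the remaining
    cases. *)
Ltac each k := do 10?[case: k => [|k]] => //.

(** The identities met below hold over the integers only up to twice some element; each use supplies
    that element as [z], which leaves a goal for [ring]. *)
Lemma eq_char2 (F : fieldType) (charF : 2%N \in [pchar F]) (z x y : F) :
  x = y + 2%:R * z -> x = y.
Proof. by rewrite (pcharf0 charF) mul0r addr0. Qed.

(** [p^-1] is a section of [p] on its image, so applying it to [p x] gives x up to an element of
    [lker p], which [f] kills. *)
Lemma lfun_factor (F : fieldType) (A B C : vectType F)
    (p : 'Hom(A, B)) (f : 'Hom(A, C)) : (lker p <= lker f)%VS ->
  exists h : 'Hom(B, C), forall x, h (p x) = f x.
Proof.
move=> kpf; exists (f \o p^-1)%VF => x; rewrite comp_lfunE.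
apply/eqP; rewrite -subr_eq0 -linearB -memv_ker; apply: (subvP kpf).
by rewrite memv_ker linearB /= subr_eq0 limg_lfunVK // memv_img ?memvf.
Qed.

Lemma ord2P (P : 'I_2 -> Prop) : P 0 -> P 1 -> forall i, P i.
Proof.
by move=> P0 P1 [[|[|i]] Hi] //;
  [have -> : Ordinal Hi = 0 | have -> : Ordinal Hi = 1] => //; apply: val_inj.
Qed.

Lemma big_ord2 (R : Type) (idx : R) (op : Monoid.law idx) (f : 'I_2 -> R) :
  \big[op/idx]_(i < 2) f i = op (f 0) (f 1).
Proof.
rewrite big_ord_recl big_ord1; congr (op (f _) (f _)); exact: val_inj.
Qed.

(** * Classes of elements of I in the section I / J *)

Section SectionProjection.
Variables (F : fieldType) (g : lieAlgType F) (I J : lieIdeal g).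

(** Linear on all of [g], but [to_sub] first projects onto [I], so this is the class of x only for x
    in [I]; hence the membership hypotheses below. *)
Definition sec_proj (x : g) : lie_section I J :=
  lie_proj (restrict_ideal I J) (to_sub I x).

Fact sec_proj_linear : linear sec_proj.
Proof. by move=> a x y; rewrite /sec_proj !linearP. Qed.
HB.instance Definition _ := GRing.isLinear.Build F g (lie_section I J)
  *:%R sec_proj sec_proj_linear.

Lemma sec_projD x y : sec_proj (x + y) = sec_proj x + sec_proj y.
Proof. exact: linearD. Qed.

Lemma sec_projZ a x : sec_proj (a *: x) = a *: sec_proj x.
Proof. exact: linearZ. Qed.

Lemma sec_proj0 : sec_proj 0 = 0.
Proof. exact: linear0. Qed.

Lemma sec_proj_eq x y : x \in I -> y \in I ->
  (sec_proj x == sec_proj y) = (x - y \in J).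
Proof.
move=> Ix Iy; rewrite /sec_proj lie_proj_eq -linearB.
by rewrite -memv_preim lfunE /= to_subK // rpredB.
Qed.

Lemma sec_proj_eq0 x : x \in I -> (sec_proj x == 0) = (x \in J).
Proof. by move=> Ix; rewrite -sec_proj0 sec_proj_eq ?mem0v // subr0. Qed.

Definition sec_repr (u : lie_section I J) : g := sub_val (lie_repr u).

Lemma sec_repr_in u : sec_repr u \in I.
Proof. exact: sub_val_in. Qed.

Lemma sec_reprK u : sec_proj (sec_repr u) = u.
Proof. by rewrite /sec_proj sub_valK lie_reprK. Qed.

Lemma section_rep_proj x y : y \in I ->
  section_rep I J x (sec_proj y) = sec_proj [lie x, y].
Proof. by move=> Iy; rewrite section_repE section_actE to_subK. Qed.

Lemma sec_proj_lie x y : x \in I -> y \in I ->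
  [lie sec_proj x, sec_proj y] = sec_proj [lie x, y].
Proof.
move=> Ix Iy; rewrite [LHS]quot_lieE; congr lie_proj.
by apply: sub_val_inj; rewrite sub_val_lie !to_subK // ideal_closed.
Qed.

End SectionProjection.

(** * The quotient map as a surjective morphism *)

Section QuotientProjection.
Variables (F : fieldType) (g : lieAlgType F) (I : lieIdeal g).

Definition quot_pi : 'Hom(g, lie_quot I) := linfun (lie_proj I).

Lemma quot_piE x : quot_pi x = lie_proj I x.
Proof. by rewrite lfunE. Qed.

Lemma quot_pi_hom : lie_hom quot_pi.
Proof. by move=> x y; rewrite !quot_piE; apply/esym/quot_lieE. Qed.

Lemma quot_pi_surj q : exists x, quot_pi x = q.
Proof. by exists (lie_repr q); rewrite quot_piE lie_reprK. Qed.

Lemma quot_pi_ker : lker quot_pi = I.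
Proof.
apply/vspaceP=> x; rewrite memv_ker quot_piE.
by rewrite -(linear0 (lie_proj I)) lie_proj_eq subr0.
Qed.

Lemma sub_incl_hom (A : lieSubalg g) : lie_hom (sub_incl A).
Proof. by move=> x y; rewrite !lfunE; apply: sub_val_lie. Qed.

End QuotientProjection.

(** * Coordinates *)

Section Coordinates.
Variables (F : fieldType) (g : lieAlgType F).

(* Coordinates 0 to 9 are s, p, q, r, t, a, b1, b2, c1, c2; those of index at
   least 6 vanish on brackets. *)
Definition sp4_bracket (x y : nat -> F) : seq F :=
  [:: x 1 * y 2 + x 2 * y 1 + x 3 * y 4 + x 4 * y 3 + x 7 * y 9 + x 9 * y 7;
      x 5 * y 1 + x 1 * y 5 + x 6 * y 4 + x 4 * y 6 + x 3 * y 9 + x 9 * y 3;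
      x 5 * y 2 + x 2 * y 5 + x 7 * y 4 + x 4 * y 7 + x 3 * y 8 + x 8 * y 3;
      x 5 * y 3 + x 3 * y 5 + x 1 * y 7 + x 7 * y 1 + x 2 * y 6 + x 6 * y 2;
      x 5 * y 4 + x 4 * y 5 + x 1 * y 8 + x 8 * y 1 + x 2 * y 9 + x 9 * y 2;
      x 6 * y 8 + x 8 * y 6 + x 7 * y 9 + x 9 * y 7].

(** The fields make [vec 0] to [vec 9] a basis with coordinate map [coordm] and bracket
    [sp4_bracket]. The derived series is computed from these data alone, without matrices. *)
Record sp4_coord := Sp4Coord {
  coordm : 'Hom(g, 'rV[F]_10);
  vec : nat -> g;
  coordm_vec : forall k, (k < 10)%N -> coordm (vec k) = delta_mx 0 (inord k);
  coordm_inj : forall x, coordm x = 0 -> x = 0;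
  coordm_lie : forall x y k, (k < 10)%N ->
    coordm [lie x, y] 0 (inord k) =
    (sp4_bracket (fun i => coordm x 0 (inord i))
                 (fun i => coordm y 0 (inord i)))`_k
}.

Variable c : sp4_coord.
Local Notation kappa := (coordm c).
Local Notation X := (vec c).

Definition cd (k : nat) (x : g) : F := kappa x 0 (inord k).

Lemma cdD k x y : cd k (x + y) = cd k x + cd k y.
Proof. by rewrite /cd linearD mxE. Qed.

Lemma cdZ k a x : cd k (a *: x) = a * cd k x.
Proof. by rewrite /cd linearZ mxE. Qed.

Lemma cd0 k : cd k 0 = 0.
Proof. by rewrite /cd linear0 mxE. Qed.

Lemma cdN k x : cd k (- x) = - cd k x.
Proof. by rewrite /cd linearN mxE. Qed.

Lemma cd_lie x y k : (k < 10)%N ->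
  cd k [lie x, y] = (sp4_bracket (cd^~ x) (cd^~ y))`_k.
Proof. exact: coordm_lie. Qed.

Lemma cdX i j : (i < 10)%N -> (j < 10)%N -> cd i (X j) = (i == j)%:R.
Proof.
move=> i10 j10.
by rewrite /cd coordm_vec // mxE eqxx -(inj_eq val_inj) /= !inordK.
Qed.

Lemma cd_inj x y : (forall k, (k < 10)%N -> cd k x = cd k y) -> x = y.
Proof.
move=> xy; apply/eqP; rewrite -subr_eq0; apply/eqP/(coordm_inj (s := c)).
rewrite linearB; apply/eqP; rewrite subr_eq0; apply/eqP/rowP=> k.
by have := xy k (ltn_ord k); rewrite /cd inord_val.
Qed.

Definition flag (n : nat) : {vspace g} := <<mkseq X n>>%VS.

Lemma memX i n : (i < n)%N -> X i \in flag n.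
Proof. by move=> i_n; apply/memv_span/map_f; rewrite mem_iota. Qed.

Lemma cd_lincomb n (w : 'I_n -> F) (i : 'I_n) : (n <= 10)%N ->
  cd i (\sum_(j < n) w j *: X j) = w i.
Proof.
move=> n10; have j10 (j : 'I_n) : (j < 10)%N := leq_trans (ltn_ord j) n10.
rewrite /cd linear_sum summxE (bigD1 i) //= big1 => [|j ji].
  by rewrite linearZ mxE -/(cd i (X i)) cdX ?eqxx ?mulr1 ?addr0.
by rewrite linearZ mxE -/(cd i (X j)) cdX // val_eqE eq_sym (negPf ji) mulr0.
Qed.

Lemma flag_cd0 n k x : (n <= k < 10)%N -> x \in flag n -> cd k x = 0.
Proof.
move=> /andP[nk k10]; rewrite /flag -[mkseq X n]/(val [tuple of mkseq X n]).
move=> /coord_span ->; rewrite /cd linear_sum summxE big1 // => i _.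
have i_k := leq_trans (ltn_ord i) nk.
rewrite linearZ mxE nth_mkseq // -/(cd k (X i)) cdX ?(ltn_trans i_k) //.
by rewrite (gtn_eqF i_k) mulr0.
Qed.

(** An element whose coordinates vanish from n on is compared with the sum of its first n
    components: all their coordinates agree. *)
Lemma flagP n x : (n <= 10)%N ->
  reflect (forall k, (n <= k < 10)%N -> cd k x = 0) (x \in flag n).
Proof.
move=> n10; apply: (iffP idP) => [xn k k10 | x0]; first exact: flag_cd0 xn.
have yn : \sum_(i < n) cd i x *: X i \in flag n.
  by apply: memv_suml => i _; apply/memvZ/memX.
suff -> : x = \sum_(i < n) cd i x *: X i by [].
apply: cd_inj => k k10; have [kn | nk] := ltnP k n.
  by rewrite (cd_lincomb (fun i => cd i x) (Ordinal kn)).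
by rewrite x0 ?(flag_cd0 _ yn) ?nk.
Qed.

Lemma dim_flag n : (n <= 10)%N -> \dim (flag n) = n.
Proof.
move=> n10; have /eqnP -> : free [tuple of mkseq X n]; last first.
  by rewrite size_tuple.
apply/freeP => w w0 i; rewrite -[LHS](cd_lincomb w i n10) -[RHS](cd0 i).
congr cd; rewrite -[RHS]w0; apply: eq_bigr => j _.
by rewrite nth_mkseq.
Qed.

Lemma flag10 : flag 10 = fullv.
Proof.
apply/vspaceP=> x; rewrite memvf; apply/flagP => // k.
by move=> /andP[k10 /(leq_ltn_trans k10)]; rewrite ltnn.
Qed.

(** This bracket and the next two produce every vector needed in the derived series: indices 3 and 4
    stay available down to L^(2), index 5 only to L^(1), and 6 and 8 only in L. *)
Lemma lieX34 : [lie X 3, X 4] = X 0.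
Proof.
by apply: cd_inj => k; each k; rewrite cd_lie //= !cdX //= => _; ring.
Qed.

Lemma lieX68 : [lie X 6, X 8] = X 5.
Proof.
by apply: cd_inj => k; each k; rewrite cd_lie //= !cdX //= => _; ring.
Qed.

(** [X 5] plays the role of a, so this is z acting as the identity on U. *)
Lemma lieX5 i : (0 < i < 5)%N -> [lie X 5, X i] = X i.
Proof.
by do 5?[case: i => [|i]] => // _; apply: cd_inj => k; each k;
  rewrite cd_lie //= !cdX //= => _; ring.
Qed.

(** One inclusion comes from the coordinates that vanish on brackets, the other from writing each
    spanning vector as a single bracket. *)
Lemma lie_prod_flag m n : (m <= 10)%N -> (n <= 10)%N ->
  (forall i, (i < n)%N ->
    exists u v, [/\ (u < m)%N, (v < m)%N & [lie X u, X v] = X i]) ->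
  (forall x y, x \in flag m -> y \in flag m ->
    forall k, (n <= k < 10)%N -> cd k [lie x, y] = 0) ->
  lie_prodv (flag m) (flag m) = flag n.
Proof.
move=> m10 n10 Xi xy0; apply/eqP; rewrite eqEsubv; apply/andP; split.
  by apply/lie_prodvP=> x y mx my; apply/flagP => //; apply: xy0.
apply/span_subvP => z /mapP[i]; rewrite mem_iota => /Xi[u [v [um vm uv]]] ->.
by rewrite -uv; apply: memv_lie; apply: memX.
Qed.

Local Notation D k := (derived g k : {vspace g}).

Lemma derived1 : D 1 = flag 6.
Proof.
transitivity (lie_prodv (flag 10) (flag 10)); first by rewrite flag10.
apply: lie_prod_flag => // [i|x y _ _ k].
  do 6?[case: i => [|i]] => // _; first by exists 3, 4; rewrite lieX34.
  1-4: by exists 5; eexists; split; last exact: lieX5.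
  by exists 6, 8; rewrite lieX68.
(* Indices 6 to 9 read past the six entries of [sp4_bracket], hence give the default 0. *)
by each k; rewrite cd_lie.
Qed.

Lemma derived2 : D 2 = flag 5.
Proof.
transitivity (lie_prodv (D 1) (D 1)) => //; rewrite derived1.
apply: lie_prod_flag => // [i|x y /flagP-/(_ isT) x0 /flagP-/(_ isT) y0 k].
  do 5?[case: i => [|i]] => // _; first by exists 3, 4; rewrite lieX34.
  1-4: by exists 5; eexists; split; last exact: lieX5.
by each k; rewrite cd_lie //= !(x0, y0) // => _; ring.
Qed.

(** On [flag 5] every term of entries 1 to 5 of the bracket has a vanishing factor, of index at
    least 5; what survives is the part of entry 0 that pairs p with q and r with t. *)
Lemma derived3 : D 3 = flag 1.
Proof.
transitivity (lie_prodv (D 2) (D 2)) => //; rewrite derived2.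
apply: lie_prod_flag => // [i|x y /flagP-/(_ isT) x0 /flagP-/(_ isT) y0 k].
  by case: i => // _; exists 3, 4; rewrite lieX34.
by each k; rewrite cd_lie //=
  ?(x0 5, y0 5, x0 6, y0 6, x0 7, y0 7, x0 8, y0 8, x0 9, y0 9) // => _; ring.
Qed.

Lemma derived4 : D 4 = flag 0.
Proof.
transitivity (lie_prodv (D 3) (D 3)) => //; rewrite derived3.
apply: lie_prod_flag => // x y /flagP-/(_ isT) x0 /flagP-/(_ isT) y0 k.
by each k; rewrite cd_lie //=
  ?(x0 1, y0 1, x0 2, y0 2, x0 3, y0 3, x0 4, y0 4, x0 5, y0 5, x0 6, y0 6,
    x0 7, y0 7, x0 8, y0 8, x0 9, y0 9) // => _; ring.
Qed.

End Coordinates.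
Arguments sp4_coord {F} g.

(** * Four-dimensional representations *)

(* U is kept abstract, and instantiated by lie_section only at the end:
   conversion problems on R x u are intractable at that concrete type. *)
Section Rep4.
Variables (F : fieldType) (g U : lieAlgType F) (c : sp4_coord g).
Variable (rho : 'Hom(g, 'End(U))).
Hypothesis charF : 2%N \in [pchar F].
Local Notation X := (vec c).
Local Notation cd := (cd c).

(* The action of x on L^(2) / L^(3), in the coordinates p, q, r, t. *)
Definition rep4_act (x y : nat -> F) : seq F :=
  [:: x 5 * y 0 + x 6 * y 3 + x 9 * y 2;
      x 5 * y 1 + x 7 * y 3 + x 8 * y 2;
      x 5 * y 2 + x 7 * y 0 + x 6 * y 1;
      x 5 * y 3 + x 8 * y 0 + x 9 * y 1].

(** A basis of U on which [rho] acts by [rep4_act]. Kernel, irreducibility and invariant form are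
    derived from these fields. *)
Record rep4_coord := Rep4Coord {
  ucoord : nat -> U -> F;
  uvec : nat -> U;
  ucD : forall k u w, (k < 4)%N -> ucoord k (u + w) = ucoord k u + ucoord k w;
  ucZ : forall k a u, (k < 4)%N -> ucoord k (a *: u) = a * ucoord k u;
  uc_inj : forall u w,
    (forall k, (k < 4)%N -> ucoord k u = ucoord k w) -> u = w;
  uc_uv : forall k j, (k < 4)%N -> (j < 4)%N -> ucoord k (uvec j) = (k == j)%:R;
  uc_act : forall k x u, (k < 4)%N ->
    ucoord k (rho x u) = (rep4_act (cd^~ x) (ucoord^~ u))`_k
}.

Variable d : rep4_coord.
Local Notation uc := (ucoord d).
Local Notation e := (uvec d).

Lemma uc_0 k : (k < 4)%N -> uc k 0 = 0.
Proof. by move=> k4; rewrite -(scale0r 0) ucZ ?mul0r. Qed.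

Lemma mem_lker_rep x : reflect (forall u, rho x u = 0) (x \in lker rho).
Proof.
rewrite memv_ker; apply: (iffP eqP) => [-> u|fx0]; first by rewrite zero_lfunE.
by apply/lfunP=> u; rewrite fx0 zero_lfunE.
Qed.

Lemma lker_rep4 : lker rho = flag c 5.
Proof.
apply/vspaceP=> x; apply/mem_lker_rep/flagP=> // [Rx0 | x0 u].
  have Rx k i : (k < 4)%N -> (i < 4)%N ->
      (rep4_act (cd^~ x) (uc^~ (e i)))`_k = 0.
    by move=> k4 i4; rewrite -uc_act // Rx0 uc_0.
  (* Each matrix entry of [rho x] used below is exactly one coordinate of x, in the order 5, 6, 7,
     8, 9. *)
  move=> k; each k => _.
  - by have := Rx 0 0 isT isT; rewrite /= !uc_uv //= => <-; ring.
  - by have := Rx 0 3 isT isT; rewrite /= !uc_uv //= => <-; ring.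
  - by have := Rx 1 3 isT isT; rewrite /= !uc_uv //= => <-; ring.
  - by have := Rx 1 2 isT isT; rewrite /= !uc_uv //= => <-; ring.
  - by have := Rx 0 2 isT isT; rewrite /= !uc_uv //= => <-; ring.
apply: (uc_inj (r := d)) => k k4; rewrite uc_act // uc_0 //.
by move: k4; each k; rewrite /= !(x0 5, x0 6, x0 7, x0 8, x0 9) // => _; ring.
Qed.

Lemma rep_uv i j k : (i < 10)%N -> (j < 4)%N -> (k < 4)%N ->
  (forall l, (l < 4)%N ->
    (rep4_act (fun m => (m == i)%:R) (fun m => (m == j)%:R))`_l
    = (l == k)%:R) ->
  rho (X i) (e j) = e k.
Proof.
move=> i10 j5 k5 E; apply: (uc_inj (r := d)) => l l4.
rewrite uc_act // uc_uv // -E //.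
by move: l4; each l; rewrite /= !cdX // !uc_uv.
Qed.

Lemma uc_sum u :
  u = uc 0 u *: e 0 + uc 1 u *: e 1 + uc 2 u *: e 2 + uc 3 u *: e 3.
Proof.
apply: (uc_inj (r := d)) => k.
by each k; rewrite !ucD // !ucZ // !uc_uv //= => _; ring.
Qed.

(** In the polynomial model [e 2], [e 1], [e 0], [e 3] are 1, X_1, X_2, X_1 X_2, while [X 6], [X 7]
    are the partial derivatives and [X 8], [X 9] the multiplications by X_1, X_2. *)
Lemma rep4_invariant (W : {vspace U}) :
  (forall x w, w \in W -> rho x w \in W) -> W = 0%VS \/ W = fullv.
Proof.
move=> op; have [->|W0] := eqVneq W 0%VS; [by left | right].
(* Reduces the search to an element of W that is a nonzero constant. *)
have W2 v : v \in W -> uc 0 v = 0 -> uc 1 v = 0 -> uc 3 v = 0 ->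
    uc 2 v != 0 -> e 2 \in W.
  move=> Wv v0 v1 v3 v2; rewrite -[e 2](scalerK v2) memvZ //.
  by move: Wv; rewrite {1}(uc_sum v) v0 v1 v3 !scale0r !add0r addr0.
have e2 : e 2 \in W.
  move: (memv_pick W) W0; rewrite -vpick0; set w := vpick W => Ww w0.
  (* The monomials X_1 X_2, X_1, X_2, 1 are tried in this order; the first one with a nonzero
     coefficient is differentiated down to a constant. *)
  have [w3|w3] := eqVneq (uc 3 w) 0; last first.
    apply: (W2 (rho (X 6) (rho (X 7) w))); first by rewrite !op.
    1-4: rewrite !uc_act //= !cdX // !uc_act //= !cdX //=.
    1-3: ring.
    by rewrite !(mul0r, mul1r, add0r, addr0).
  have [w1|w1] := eqVneq (uc 1 w) 0; last first.
    apply: (W2 (rho (X 6) w)); first by rewrite !op.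
    1-4: rewrite !uc_act //= !cdX //= ?w3.
    1-3: ring.
    by rewrite !(mul0r, mul1r, add0r, addr0).
  have [wp|wp] := eqVneq (uc 0 w) 0; last first.
    apply: (W2 (rho (X 7) w)); first by rewrite !op.
    1-4: rewrite !uc_act //= !cdX //= ?w3.
    1-3: ring.
    by rewrite !(mul0r, mul1r, add0r, addr0).
  apply: (W2 w) => //; apply: contraNneq w0 => w2.
  by rewrite (uc_sum w) w1 w2 w3 wp !scale0r !addr0.
(* Multiplications rebuild X_1, X_2 and X_1 X_2 from 1. *)
have e1 : e 1 \in W.
  by rewrite -(@rep_uv 8 2) ?op // => l; each l => _ /=; ring.
have e0 : e 0 \in W.
  by rewrite -(@rep_uv 9 2) ?op // => l; each l => _ /=; ring.
have e3 : e 3 \in W.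
  by rewrite -(@rep_uv 8 0) ?op // => l; each l => _ /=; ring.
by apply/vspaceP=> u; rewrite memvf (uc_sum u) !rpredD // memvZ.
Qed.

Lemma fullv_neq0 : {:U}%VS <> 0%VS.
Proof.
move=> U0; have: e 0 \in {:U}%VS by exact: memvf.
rewrite U0 memv0 => /eqP e0; have := @uc_uv d 0 0 isT isT.
by rewrite e0 uc_0 // => /eqP; rewrite eq_sym oner_eq0.
Qed.

Lemma rep4_irreducible : irreducible_rep rho.
Proof.
split=> [|W invW]; first exact: fullv_neq0.
apply: rep4_invariant => x w Ww.
by apply: (subvP (invW x)); apply: memv_img.
Qed.

(** The bracket of L^(2) in the coordinates p, q, r, t. With plus signs throughout, it is
    alternating because of characteristic 2. *)
Definition uform (u w : U) : F :=
  uc 0 u * uc 1 w + uc 1 u * uc 0 w + uc 2 u * uc 3 w + uc 3 u * uc 2 w.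

Fact uform_linearl u : linear_for *%R (uform ^~ u).
Proof. by move=> a v w; rewrite /uform !ucD // !ucZ //; ring. Qed.

Fact uform_linearr u : linear_for *%R (uform u).
Proof. by move=> a v w; rewrite /uform !ucD // !ucZ //; ring. Qed.

HB.instance Definition _ := bilinear_isBilinear.Build F U U F *%R *%R uform
  (uform_linearl, uform_linearr).

Lemma uform_alt : alternating_form uform.
Proof.
move=> u; apply: (@eq_char2 _ charF (uc 0 u * uc 1 u + uc 2 u * uc 3 u)).
by rewrite /= /uform; ring.
Qed.

(** Pairing with the partner basis vector, 0 with 1 and 2 with 3, reads off each coordinate. *)
Lemma uform_nondeg : nondegenerate_form uform.
Proof.
move=> u u0.
have u_ i : (i < 4)%N -> uform u (e i) = 0 by move=> _; apply: u0.
apply: (uc_inj (r := d)) => k k4; rewrite uc_0 //; move: k4; each k => _.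
- by rewrite -(u_ 1) // /uform !uc_uv //=; ring.
- by rewrite -(u_ 0) // /uform !uc_uv //=; ring.
- by rewrite -(u_ 3) // /uform !uc_uv //=; ring.
- by rewrite -(u_ 2) // /uform !uc_uv //=; ring.
Qed.

Lemma uform_inv x u w : uform (rho x u) w + uform u (rho x w) = 0.
Proof.
(* Every monomial of the expanded sum occurs twice; the witness contains each of them once. *)
rewrite /uform !uc_act //=; apply: (@eq_char2 _ charF
  (cd 5 x * uform u w + cd 6 x * (uc 3 u * uc 1 w + uc 1 u * uc 3 w)
   + cd 7 x * (uc 3 u * uc 0 w + uc 0 u * uc 3 w)
   + cd 8 x * (uc 2 u * uc 0 w + uc 0 u * uc 2 w)
   + cd 9 x * (uc 2 u * uc 1 w + uc 1 u * uc 2 w))).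
by rewrite /uform; ring.
Qed.

End Rep4.

(** * The quotient L / L^(2), its faithful representation and its identification with h(2) *)

Section Quotient.
Variables (F : fieldType) (g Q : lieAlgType F) (c : sp4_coord g).
Variable (pi : 'Hom(g, Q)).
Hypothesis charF : 2%N \in [pchar F].
Hypothesis pi_hom : lie_hom pi.
Hypothesis pi_surj : forall q, exists x, pi x = q.
Hypothesis pi_ker : lker pi = flag c 5.
Local Notation X := (vec c).
Local Notation cd := (cd c).

Section Rep.
Variables (U : lieAlgType F) (rho : 'Hom(g, 'End(U))) (d : rep4_coord c rho).
Hypothesis rho_hom : lie_hom rho.

Lemma rep_factor : exists S : 'Hom(Q, 'End(U)), forall x, S (pi x) = rho x.
Proof. by apply: lfun_factor; rewrite pi_ker (lker_rep4 d). Qed.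

(** Rank and nullity: the source has dimension 10 and the kernel is [flag c 5]. *)
Lemma dim_limg_rep : \dim (limg rho) = 5%N.
Proof.
have := limg_ker_dim rho fullv.
rewrite capfv (lker_rep4 d) -(flag10 c) !dim_flag //.
by move/eqP; rewrite (eqn_add2l 5 _ 5) => /eqP.
Qed.

Lemma limg_rep_form : (limg rho <= form_lie (uform d))%VS.
Proof.
apply/subvP=> _ /memv_imgP[x _ ->]; apply/form_lieP=> v w.
by apply/eqP; rewrite -addr_eq0; apply/eqP; apply: uform_inv.
Qed.

Fact limg_rep_closed y z :
  y \in limg rho -> z \in limg rho -> [lie y, z] \in limg rho.
Proof.
move=> /memv_imgP[x _ ->] /memv_imgP[t _ ->].
by rewrite -rho_hom memv_img ?memvf.
Qed.

Definition limg_rep : lieSubalg 'End(U) := LieSubalg limg_rep_closed.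

Lemma limg_rep_irreducible : irreducible_rep (sub_incl limg_rep).
Proof.
split=> [|W invW]; first exact: (fullv_neq0 d).
apply: (rep4_invariant d) => x w Ww.
have := subvP (invW (to_sub limg_rep (rho x))) _ (memv_img _ Ww).
by rewrite lfunE /= to_subK //; apply/memv_img/memvf.
Qed.

Variable S : 'Hom(Q, 'End(U)).
Hypothesis S_pi : forall x, S (pi x) = rho x.

Lemma factor_hom : lie_hom S.
Proof.
move=> p q; have [x <-] := pi_surj p; have [y <-] := pi_surj q.
by rewrite -pi_hom !S_pi rho_hom.
Qed.

Lemma factor_ker : lker S = 0%VS.
Proof.
apply/vspaceP=> q; have [x <-] := pi_surj q.
rewrite memv0 memv_ker S_pi -memv_ker (lker_rep4 d) -pi_ker.
by rewrite memv_ker.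
Qed.

Lemma factor_irreducible : irreducible_rep S.
Proof.
split=> [|W invW]; first exact: (fullv_neq0 d).
apply: (rep4_invariant d) => x w Ww; rewrite -S_pi.
by apply: (subvP (invW (pi x))); apply: memv_img.
Qed.

Lemma factor_limg : limg S = limg rho.
Proof.
apply/vspaceP=> y; apply/memv_imgP/memv_imgP=> [[q _ ->]|[x _ ->]].
  by have [x <-] := pi_surj q; exists x; rewrite ?memvf ?S_pi.
by exists (pi x); rewrite ?memvf ?S_pi.
Qed.

End Rep.

(** A linear lift, not a Lie morphism: [X 7] and [X 9] bracket to [X 0 + X 5], while u_2 and v_2
    bracket to z, lifted to [X 5]. Such defects lie in the kernel of [pi]. *)
Definition hlift (h : heisenberg F 2) : g :=
  h.1.1 0 0 *: X 6 + h.1.1 0 1 *: X 7 + h.1.2 0 0 *: X 8 + h.1.2 0 1 *: X 9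
  + (h.2 : F) *: X 5.

Fact hlift_linear : linear hlift.
Proof.
move=> a h k; apply: (@cd_inj _ _ c) => i _.
by rewrite /hlift !(cdD, cdZ) !mxE /=; rewrite /GRing.scale /=; ring.
Qed.
HB.instance Definition _ := GRing.isLinear.Build F (heisenberg F 2) g *:%R
  hlift hlift_linear.

Lemma cd_hlift h :
  [/\ cd 5 (hlift h) = h.2, cd 6 (hlift h) = h.1.1 0 0,
      cd 7 (hlift h) = h.1.1 0 1,
      cd 8 (hlift h) = h.1.2 0 0 & cd 9 (hlift h) = h.1.2 0 1].
Proof. by split; rewrite !(cdD, cdZ) !cdX //=; ring. Qed.

Definition htheta : 'Hom(heisenberg F 2, Q) := (pi \o linfun hlift)%VF.

Lemma hthetaE h : htheta h = pi (hlift h).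
Proof. by rewrite comp_lfunE lfunE. Qed.

Lemma pi_eq x y : (forall k, (5 <= k < 10)%N -> cd k x = cd k y) -> pi x = pi y.
Proof.
move=> xy; apply/eqP; rewrite -subr_eq0 -linearB /= -memv_ker pi_ker.
by apply/flagP=> // k k10; rewrite cdD cdN xy // subrr.
Qed.

Lemma pi_eqP x y k : pi x = pi y -> (5 <= k < 10)%N -> cd k x = cd k y.
Proof.
move=> /eqP; rewrite -subr_eq0 -linearB /= -memv_ker pi_ker.
move=> /flagP-/(_ isT) xy k10.
by have /eqP := xy k k10; rewrite cdD cdN subr_eq0 => /eqP.
Qed.

Lemma htheta_u i : htheta (heis_u i) = pi (X (6 + i)).
Proof.
rewrite hthetaE /hlift /= !mxE !eqxx /=; congr (pi _).
by case: i => [[|[|i]] ?] //=; rewrite !(scale0r, scale1r, addr0, add0r).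
Qed.

Lemma htheta_v i : htheta (heis_v i) = pi (X (8 + i)).
Proof.
rewrite hthetaE /hlift /= !mxE !eqxx /=; congr (pi _).
by case: i => [[|[|i]] ?] //=; rewrite !(scale0r, scale1r, addr0, add0r).
Qed.

Lemma htheta_z : htheta heis_z = pi (X 5).
Proof.
by rewrite hthetaE /hlift /= !mxE !(scale0r, scale1r, addr0, add0r).
Qed.

Lemma htheta_iso : lie_iso htheta.
Proof.
have opp2 (x : F) : - x = x by rewrite oppr_pchar2.
split=> [h k|].
  rewrite !hthetaE -pi_hom; apply: pi_eq => i.
  have [h5 h6 h7 h8 h9] := cd_hlift h; have [k5 k6 k7 k8 k9] := cd_hlift k.
  have [l5 l6 l7 l8 l9] := cd_hlift [lie h, k].
  each i => _; rewrite ?(l5, l6, l7, l8, l9) cd_lie //= ?mxE //.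
  by rewrite h6 h7 h8 h9 k6 k7 k8 k9 big_ord2 /= !opp2; ring.
(* The inverse reads coordinates 5 to 9 of a chosen preimage; by [pi_eqP] they do not depend on the
   choice. *)
have inv q := sig_eqW (pi_surj q).
pose psi q : heisenberg F 2 := let x := projT1 (inv q) in
  (\row_(i < 2) cd (6 + i) x, \row_(i < 2) cd (8 + i) x, cd 5 x).
exists psi => [h | q].
  rewrite /psi; case: (inv _) => x /=; rewrite hthetaE => /pi_eqP xh.
  have [h5 h6 h7 h8 h9] := cd_hlift h.
  case: h h5 h6 h7 h8 h9 xh => [[u v] z] /= h5 h6 h7 h8 h9 xh.
  congr (_, _, _).
  - by apply/rowP; apply: ord2P; rewrite mxE xh.
  - by apply/rowP; apply: ord2P; rewrite mxE xh.
  - by rewrite xh.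
rewrite hthetaE /psi; case: (inv q) => x /= <-; apply: pi_eq => k.
set h := (_, _, _); have [h5 h6 h7 h8 h9] := cd_hlift h.
by each k => _; rewrite ?(h5, h6, h7, h8, h9) ?mxE.
Qed.

End Quotient.

(** * L^(2) as a copy of h(2) *)

Section Subalgebra.
Variables (F : fieldType) (g N : lieAlgType F) (c : sp4_coord g).
Variables (iota : 'Hom(N, g)) (ret : g -> N).
Hypothesis charF : 2%N \in [pchar F].
Hypothesis iota_hom : lie_hom iota.
Hypothesis iota_in : forall y, iota y \in flag c 5.
Hypothesis retK : forall x, x \in flag c 5 -> iota (ret x) = x.
Hypothesis iota_inj : injective iota.
Local Notation X := (vec c).
Local Notation cd := (cd c).

(** The pairs (p, q) and (r, t), matched by the bracket, become (u_1, v_1) and (u_2, v_2); the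
    central coordinate is s. *)
Definition hcoord (x : g) : heisenberg F 2 :=
  (\row_(i < 2) cd i.*2.+1 x, \row_(i < 2) cd i.*2.+2 x, cd 0 x).

Fact hcoord_linear : linear hcoord.
Proof.
move=> a x y; congr (_, _, _); last by rewrite cdD cdZ.
  by apply/rowP=> i; rewrite !mxE cdD cdZ.
by apply/rowP=> i; rewrite !mxE cdD cdZ.
Qed.
HB.instance Definition _ := GRing.isLinear.Build F g (heisenberg F 2) *:%R
  hcoord hcoord_linear.

Lemma hcoord_iso : lie_iso (linfun hcoord \o iota)%VF.
Proof.
have opp2 (x : F) : - x = x by rewrite oppr_pchar2.
split=> [y z|].
  rewrite !comp_lfunE !lfunE /= iota_hom.
  have /flagP-/(_ isT) y0 := iota_in y; have /flagP-/(_ isT) z0 := iota_in z.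
  have cd0 k : (0 < k < 5)%N -> cd k [lie iota y, iota z] = 0.
    each k; rewrite cd_lie //= !(y0 5, y0 6, y0 7, y0 8, y0 9) //
      !(z0 5, z0 6, z0 7, z0 8, z0 9) // => _.
    1-4: ring.
  congr (_, _, _).
  - by apply/rowP; apply: ord2P; rewrite !mxE cd0.
  - by apply/rowP; apply: ord2P; rewrite !mxE cd0.
  rewrite cd_lie //= big_ord2 /= !opp2 !mxE /=.
  by rewrite (y0 7) // (y0 9) //; ring.
(* The inverse of [hcoord] on [flag c 5], which [ret] carries back to [N]. *)
pose lift5 (h : heisenberg F 2) : g := (h.2 : F) *: X 0
  + h.1.1 0 0 *: X 1 + h.1.2 0 0 *: X 2 + h.1.1 0 1 *: X 3 + h.1.2 0 1 *: X 4.
have lift_in h : lift5 h \in flag c 5.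
  by rewrite !rpredD // memvZ // memX.
exists (fun h => ret (lift5 h)) => [y|h]; last first.
  rewrite comp_lfunE lfunE /= retK //; case: h => [[u v] z].
  congr (_, _, _).
  - by apply/rowP; apply: ord2P; rewrite mxE !(cdD, cdZ) !cdX //=; ring.
  - by apply/rowP; apply: ord2P; rewrite mxE !(cdD, cdZ) !cdX //=; ring.
  - by rewrite !(cdD, cdZ) !cdX //=; ring.
apply: iota_inj; rewrite retK // comp_lfunE lfunE /=.
have /flagP-/(_ isT) y0 := iota_in y.
apply: (@cd_inj _ _ c) => k; rewrite /lift5 /= !mxE.
by each k => _; rewrite !(cdD, cdZ) !cdX //=
  ?(y0 5, y0 6, y0 7, y0 8, y0 9) //; ring.
Qed.

End Subalgebra.

(** * Truncated polynomials *)

Section TruncPoly.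
Variable (F : fieldType).
Local Notation P := {mpoly F[2]}.

(** Every monomial in a multiple of the square of a variable has exponent at least 2 in that
    variable. *)
Lemma squares_coef n (p : {mpoly F[n]}) (m : 'X_{1..n}) :
  p \in squares_submodule F n -> (forall i, m i <= 1)%N -> p@_m = 0.
Proof.
move=> /asboolP[c ->] m1; rewrite linear_sum big1 // => i _ /=.
rewrite mpolyXn mcoeffM big1 // => k /eqP mk; rewrite mcoeffX.
case: eqP => [k2|_]; last by rewrite mulr0.
have := congr1 (fun m' : 'X_{1..n} => m' i) mk; have := m1 i.
by rewrite mnmDE -k2 mulmnE mnm1E eqxx mul1n addn2 => /[swap] ->.
Qed.

(* a + b X_1 + s X_2 + t X_1 X_2, in the notation of the statement. *)
Definition tpoly (a b s t : F) : P :=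
  a%:MP + b *: 'X_0 + s *: 'X_1 + t *: ('X_0 * 'X_1).

Lemma tpolyD a b s t a' b' s' t' :
  tpoly (a + a') (b + b') (s + s') (t + t') = tpoly a b s t + tpoly a' b' s' t'.
Proof. by rewrite /tpoly -!mul_mpolyC !mpolyCD; ring. Qed.

Lemma tpolyZ k a b s t :
  tpoly (k * a) (k * b) (k * s) (k * t) = k *: tpoly a b s t.
Proof. by rewrite /tpoly -!mul_mpolyC !mpolyCM; ring. Qed.

Lemma tpoly_coef a b s t :
  [/\ (tpoly a b s t)@_0%MM = a, (tpoly a b s t)@_U_(0%R)%MM = b,
      (tpoly a b s t)@_U_(1%R)%MM = s
    & (tpoly a b s t)@_(U_(0%R) + U_(1%R))%MM = t].
Proof.
have E (m m' : 'X_{1..2}) : (m == m') = (m 0 == m' 0) && (m 1 == m' 1).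
  apply/eqP/andP=> [-> // | [/eqP m0 /eqP m1]].
  by apply/mnmP; apply: ord2P.
rewrite /tpoly -mpolyXD.
by split; rewrite !mcoeffD !mcoeffZ mcoeffC !mcoeffX !E
  !(mnmDE, mnm1E, mnm0E) /= !(mulr0, mulr1, addr0, add0r).
Qed.

(** Turns equality of classes into a polynomial identity with explicit cofactors of the two squares,
    within reach of [ring]. *)
Lemma trunc_proj_eq (p q : P) (c0 c1 : P) :
  p = q + c0 * 'X_0 ^+ 2 + c1 * 'X_1 ^+ 2 -> trunc_proj p = trunc_proj q.
Proof.
move=> pq; apply/eqP; rewrite lproj_eq; apply/asboolP.
exists (fun i => if i == 0 then c0 else c1).
rewrite big_ord2 /=.
by rewrite pq; ring.
Qed.

(** By linearity monomials suffice: four are square-free, and any other is an explicit multiple of a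
    square, hence zero. *)
Lemma tpoly_surj (x : trunc_poly F 2) :
  exists a b s t, trunc_proj (tpoly a b s t) = x.
Proof.
rewrite -[x]trunc_reprK; elim/mpolyind: (trunc_repr x) => {x}
    [|k m p _ _ [a [b [s [t IH]]]]].
  by exists 0, 0, 0, 0; rewrite /tpoly !scale0r !addr0.
have [a' [b' [s' [t' E]]]] :
    exists a b s t, trunc_proj (tpoly a b s t) = trunc_proj ('X_[m] : P).
  rewrite mpolyXE_id big_ord2 /=.
  case: (m 0) => [|[|i]].
  - case: (m 1) => [|[|j]].
    + by exists 1, 0, 0, 0; rewrite /tpoly -!mul_mpolyC mpolyC0 mpolyC1;
        congr trunc_proj; ring.
    + by exists 0, 0, 1, 0; rewrite /tpoly -!mul_mpolyC mpolyC0 mpolyC1;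
        congr trunc_proj; ring.
    exists 0, 0, 0, 0; symmetry; apply: (@trunc_proj_eq _ _ 0 ('X_1 ^+ j)).
    by rewrite /tpoly -!mul_mpolyC mpolyC0 -[j.+2]addn2 exprD; ring.
  - case: (m 1) => [|[|j]].
    + by exists 0, 1, 0, 0; rewrite /tpoly -!mul_mpolyC mpolyC0 mpolyC1;
        congr trunc_proj; ring.
    + by exists 0, 0, 0, 1; rewrite /tpoly -!mul_mpolyC mpolyC0 mpolyC1;
        congr trunc_proj; ring.
    exists 0, 0, 0, 0; symmetry.
    apply: (@trunc_proj_eq _ _ 0 ('X_0 * 'X_1 ^+ j)).
    by rewrite /tpoly -!mul_mpolyC mpolyC0 -[j.+2]addn2 exprD; ring.
  exists 0, 0, 0, 0; symmetry.
  apply: (@trunc_proj_eq _ _ ('X_0 ^+ i * 'X_1 ^+ m 1) 0).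
  by rewrite /tpoly -!mul_mpolyC mpolyC0 -[i.+2]addn2 exprD; ring.
exists (k * a' + a), (k * b' + b), (k * s' + s), (k * t' + t).
by rewrite tpolyD tpolyZ !trunc_proj_linear E IH.
Qed.

(** The difference lies in the ideal, so by [squares_coef] its four square-free coefficients
    vanish. *)
Lemma tpoly_inj a b s t a' b' s' t' :
  trunc_proj (tpoly a b s t) = trunc_proj (tpoly a' b' s' t') ->
  [/\ a = a', b = b', s = s' & t = t'].
Proof.
move=> /eqP; rewrite lproj_eq => sq.
have E (m : 'X_{1..2}) : (forall i, m i <= 1)%N ->
    (tpoly a b s t)@_m = (tpoly a' b' s' t')@_m.
  by move=> m1; apply/eqP; rewrite -subr_eq0 -mcoeffB (squares_coef sq).
have [c0 c1 c2 c3] := tpoly_coef a b s t.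
have [d0 d1 d2 d3] := tpoly_coef a' b' s' t'.
by split; [rewrite -c0 -d0 | rewrite -c1 -d1 | rewrite -c2 -d2
    | rewrite -c3 -d3];
  apply: E; apply: ord2P; rewrite !(mnmDE, mnm1E, mnm0E).
Qed.

Lemma poly_act_tpoly (h : heisenberg F 2) a b s t :
  2%N \in [pchar F] ->
  trunc_act h (trunc_proj (tpoly a b s t)) = trunc_proj (tpoly
    (h.2 * a + h.1.1 0 0 * b + h.1.1 0 1 * s)
    (h.2 * b + h.1.1 0 1 * t + h.1.2 0 0 * a)
    (h.2 * s + h.1.1 0 0 * t + h.1.2 0 1 * a)
    (h.2 * t + h.1.2 0 0 * s + h.1.2 0 1 * b)).
Proof.
move=> charF; rewrite trunc_actE //.
(* Multiplying by a variable the two terms that already contain it creates a square; these cofactors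
   collect those products. *)
apply: (@trunc_proj_eq _ _ ((h.1.2 0 0)%:MP * (b%:MP + t *: 'X_1))
  ((h.1.2 0 1)%:MP * (s%:MP + t *: 'X_0))).
have DX (i j : 'I_2) : ('X_j : P)^`M(i) = (i == j)%:R.
  rewrite mderivX mnm1E eq_sym; case: eqP => [->|_]; last by rewrite scale0r.
  by rewrite scale1r -[U_(j)%MM in X in (X - _)%MM]add0m addmK mpolyX0.
rewrite /poly_act !big_ord2 /=.
rewrite /tpoly !mderivD !mderivC !mderivZ !mderivM !DX /=.
rewrite -!mul_mpolyC !mpolyCD !mpolyCM.
ring.
Qed.

Section Iso.
Variables (g U Q : lieAlgType F) (c : sp4_coord g) (pi : 'Hom(g, Q)).
Variables (rho : 'Hom(g, 'End(U))) (d : rep4_coord c rho).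
Variable S : 'Hom(Q, 'End(U)).
Hypothesis charF : 2%N \in [pchar F].
Hypothesis S_pi : forall x, S (pi x) = rho x.
Local Notation uc := (ucoord d).

Definition uphi (u : U) : trunc_poly F 2 :=
  trunc_proj (tpoly (uc 2 u) (uc 1 u) (uc 0 u) (uc 3 u)).

Fact uphi_linear : linear uphi.
Proof.
by move=> k u v; rewrite /uphi !ucD // !ucZ // tpolyD tpolyZ trunc_proj_linear.
Qed.
HB.instance Definition _ := GRing.isLinear.Build F U (trunc_poly F 2) *:%R
  uphi uphi_linear.

Lemma trunc_module_iso :
  module_isomorphic (fun (x : heisenberg F 2) (u : U) => S (htheta c pi x) u)
    (@trunc_act F 2).
Proof.
exists uphi; split.
  have uphi_inj : injective uphi.
    move=> u w /tpoly_inj[u2 u1 u0 u3]; apply: (uc_inj (r := d)).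
    by do 4?[case=> [|]] => //.
  have surj x : exists u, uphi u = x.
    have [a [b [s [t <-]]]] := tpoly_surj x.
    exists (s *: uvec d 0 + b *: uvec d 1 + a *: uvec d 2 + t *: uvec d 3).
    rewrite /uphi !ucD // !ucZ // !uc_uv //=.
    by congr (trunc_proj (tpoly _ _ _ _)); ring.
  exists (fun x => projT1 (sig_eqW (surj x))) => [u|x]; last first.
    by case: (sig_eqW _).
  by apply: uphi_inj; case: (sig_eqW _).
move=> h u /=; rewrite hthetaE S_pi /uphi poly_act_tpoly // !uc_act //=.
have [-> -> -> -> ->] := cd_hlift c h.
by congr (trunc_proj (tpoly _ _ _ _)); ring.
Qed.

End Iso.
End TruncPoly.

(** * Matrices *)

Local Notation l0 := (lshift 2 (0 : 'I_2)).
Local Notation l1 := (lshift 2 (1 : 'I_2)).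
Local Notation r0 := (rshift 2 (0 : 'I_2)).
Local Notation r1 := (rshift 2 (1 : 'I_2)).

Lemma big_ord4 (R : zmodType) (h : 'I_(2 + 2) -> R) :
  \sum_(i < 2 + 2) h i = h l0 + h l1 + h r0 + h r1.
Proof. by rewrite big_split_ord !big_ord2 /= addrA. Qed.

Section MatrixCoordinates.
Variables (F : fieldType) (V : vectType F) (f : {biscalar V}) (n : nat).
Variable (e : (n + n).-tuple V).
Hypothesis e_sympl : symplectic_basis f e.

Let e_basis : basis_of {:V} e. Proof. by case: e_sympl. Qed.
Let e_free : free e. Proof. exact: basis_free e_basis. Qed.

Definition ent (i j : 'I_(n + n)) (x : 'End(V)) : F := coord e i (x e`_j).

Lemma vec_sum v : v = \sum_i coord e i v *: e`_i.
Proof. by apply: coord_basis e_basis _; apply: memvf. Qed.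

Lemma ent_mx_end M i j : ent i j (mx_end e M) = M i j.
Proof. by rewrite /ent mx_endE // (coord_sum_free (fun k => M k j)). Qed.

Lemma ent_inj x y : (forall i j, ent i j x = ent i j y) -> x = y.
Proof.
move=> xy; apply/lfunP=> v; rewrite (vec_sum v) !linear_sum.
apply: eq_bigr => j _; rewrite !linearZ /=; congr (_ *: _).
rewrite (vec_sum (x _)) (vec_sum (y _)); apply: eq_bigr => i _.
by rewrite -!/(ent _ _ _) xy.
Qed.

Lemma ent_comp (x y : 'End(V)) (i j : 'I_(n + n)) :
  coord e i (x (y e`_j)) = \sum_k ent i k x * ent k j y.
Proof.
rewrite (vec_sum (y _)) !linear_sum; apply: eq_bigr => k _.
by rewrite !linearZ /= mulrC.
Qed.

Lemma ent_lie (x y : 'End(V)) i j : ent i j [lie x, y] =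
  \sum_k (ent i k x * ent k j y - ent i k y * ent k j x).
Proof. by rewrite /ent gl_lieE linearB /= !ent_comp sumrB. Qed.

(** One tuple of rewrite rules for the four blocks, with indices as natural numbers so that they
    match [nth]. *)
Let gram (i j : 'I_n) :
  (f e`_i e`_j = 0) * (f e`_i e`_(n + j) = (i == j)%:R) *
  (f e`_(n + i) e`_j = - (i == j)%:R) * (f e`_(n + i) e`_(n + j) = 0).
Proof.
case: e_sympl => _ fe.
have := fe (lshift n i) (lshift n j); rewrite block_mxEul mxE /= => ->.
have := fe (lshift n i) (rshift n j); rewrite block_mxEur mxE /= => ->.
have := fe (rshift n i) (lshift n j); rewrite block_mxEdl !mxE /= => ->.
by have := fe (rshift n i) (rshift n j); rewrite block_mxEdr mxE /= => ->.
Qed.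

(** Here and in the next three lemmas, pairing with a basis vector reads off, up to sign, the
    coordinate at its dual partner. *)
Lemma form_basis_r v (k : 'I_n) : f v e`_(n + k) = coord e (lshift n k) v.
Proof.
rewrite {1}(vec_sum v) linear_sumlz big_split_ord /=.
rewrite (bigD1 k) //= big1 ?big1 => [|i _|i ik];
  rewrite linearZl_LR /= gram ?mulr0 //.
  by rewrite eqxx mulr1 !addr0.
by rewrite (negPf ik) mulr0.
Qed.

Lemma form_basis_l v (k : 'I_n) : f v e`_k = - coord e (rshift n k) v.
Proof.
rewrite {1}(vec_sum v) linear_sumlz big_split_ord /= addrC.
rewrite (bigD1 k) //= big1 ?big1 => [|i _|i ik];
  rewrite linearZl_LR /= gram ?mulr0 //.
  by rewrite eqxx mulrN1 !addr0.
by rewrite (negPf ik) oppr0 mulr0.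
Qed.

Lemma form_basisl v (k : 'I_n) : f e`_k v = coord e (rshift n k) v.
Proof.
rewrite {1}(vec_sum v) linear_sumr big_split_ord /= addrC.
rewrite (bigD1 k) //= big1 ?big1 => [|i _|i ik];
  rewrite linearZr_LR /= gram ?mulr0 //.
  by rewrite eqxx mulr1 !addr0.
by rewrite eq_sym (negPf ik) mulr0.
Qed.

Lemma form_basisr v (k : 'I_n) : f e`_(n + k) v = - coord e (lshift n k) v.
Proof.
rewrite {1}(vec_sum v) linear_sumr big_split_ord /=.
rewrite (bigD1 k) //= big1 ?big1 => [|i _|i ik];
  rewrite linearZr_LR /= gram ?mulr0 //.
  by rewrite eqxx mulrN1 !addr0.
by rewrite eq_sym (negPf ik) oppr0 mulr0.
Qed.

Definition form_basisE :=
  (form_basis_r, form_basis_l, form_basisr, form_basisl).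

(** Invariance tested on pairs of basis vectors: the off-diagonal blocks are symmetric and the lower
    right block is minus the transpose of the upper left one, in any characteristic. *)
Lemma form_lie_entP x : reflect (forall i j : 'I_n,
    [/\ ent (rshift n i) (lshift n j) x = ent (rshift n j) (lshift n i) x,
        ent (lshift n i) (rshift n j) x = ent (lshift n j) (rshift n i) x
      & ent (rshift n i) (rshift n j) x = - ent (lshift n j) (lshift n i) x])
  (x \in form_lie f).
Proof.
apply: (iffP (form_lieP _ _)) => [xf i j | xE v w].
  have ll := xf e`_(lshift n j) e`_(lshift n i).
  have lr := xf e`_(lshift n i) e`_(rshift n j).
  have rr := xf e`_(rshift n j) e`_(rshift n i).
  rewrite !form_basisE in ll lr rr.
  split; [exact: oppr_inj | by rewrite [LHS]rr opprK |].
  by rewrite [X in - X]lr opprK.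
have xe (i j : 'I_(n + n)) : f (x e`_i) e`_j = - f e`_i (x e`_j).
  rewrite -(splitK i) -(splitK j).
  case: (split i) => i'; case: (split j) => j' /=.
  - by have [E _ _] := xE i' j'; rewrite !form_basisE; congr (- _).
  - have [_ _ E] := xE i' j'; rewrite !form_basisE.
    by apply: oppr_inj; rewrite opprK.
  - by have [_ _ E] := xE j' i'; rewrite !form_basisE; congr (- _).
  by have [_ E _] := xE i' j'; rewrite !form_basisE opprK.
(* Bilinearity extends the identity from basis vectors, first in v, then in w. *)
have xv (i : 'I_(n + n)) : f (x v) e`_i = - f v (x e`_i).
  rewrite (vec_sum v) linear_sum !linear_sumlz -sumrN.
  by apply: eq_bigr => j _; rewrite linearZ /= !linearZl_LR /= xe mulrN.
rewrite (vec_sum w) (linear_sum x) !linear_sumr -sumrN.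
by apply: eq_bigr => j _; rewrite (linearZ_LR x) /= !linearZr_LR /= xv mulrN.
Qed.

End MatrixCoordinates.

(** * The ten coordinates on L in characteristic 2 *)

Section Sp4.
Variables (F : fieldType) (V : vectType F) (f : {biscalar V}).
Variable (e : (2 + 2).-tuple V).
Hypothesis charF : 2%N \in [pchar F].
Hypothesis e_sympl : symplectic_basis f e.
Local Notation L := (lie_sub (form_lie f)).

Let opp2 (x : F) : - x = x. Proof. by rewrite oppr_pchar2. Qed.

Definition mat2 (a b c d : F) : 'M[F]_2 :=
  \matrix_(i, j) (if i == 0 then if j == 0 then a else b
                  else if j == 0 then c else d).

(** The diagonal is written with s + a and s so that vector 0 is the identity and vector 5 is the
    element a. *)
Definition spmx (w : nat -> F) : 'M[F]_(2 + 2) :=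
  block_mx (mat2 (w 0 + w 5) (w 1) (w 2) (w 0)) (mat2 (w 6) (w 3) (w 3) (w 7))
           (mat2 (w 8) (w 4) (w 4) (w 9)) (mat2 (w 0 + w 5) (w 2) (w 1) (w 0)).

Lemma spmx_in w : mx_end e (spmx w) \in form_lie f.
Proof.
apply/(form_lie_entP e_sympl); do 2 apply: ord2P;
  rewrite !(ent_mx_end e_sympl);
  by rewrite !(block_mxEul, block_mxEur, block_mxEdl, block_mxEdr) !mxE /=
    ?opp2.
Qed.

Definition spseq (x : 'End(V)) : seq F :=
  [:: ent e l1 l1 x; ent e l0 l1 x; ent e l1 l0 x; ent e l0 r1 x; ent e r1 l0 x;
      ent e l0 l0 x - ent e l1 l1 x; ent e l0 r0 x; ent e l1 r1 x;
      ent e r0 l0 x; ent e r1 l1 x].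

Definition spcoord (x : 'End(V)) : 'rV[F]_10 := \row_k (spseq x)`_k.

Fact spcoord_linear : linear spcoord.
Proof.
have entP a i j x y : ent e i j (a *: x + y) = a * ent e i j x + ent e i j y.
  by rewrite /ent add_lfunE scale_lfunE linearP.
move=> a x y; apply/rowP=> -[k k10]; rewrite !mxE /spseq /= !entP.
by move: k10; each k => _ /=; ring.
Qed.
HB.instance Definition _ := GRing.isLinear.Build F 'End(V) 'rV[F]_10 *:%R
  spcoord spcoord_linear.

Definition spvec (k : nat) : L :=
  to_sub (form_lie f) (mx_end e (spmx (fun i => (i == k)%:R))).

Definition spcoordL : 'Hom(L, 'rV[F]_10) :=
  (linfun spcoord \o sub_incl (form_lie f))%VF.

Lemma spcoordLE x : spcoordL x = spcoord (sub_val x).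
Proof. by rewrite comp_lfunE !lfunE. Qed.

Fact spcoord_vec k : (k < 10)%N -> spcoordL (spvec k) = delta_mx 0 (inord k).
Proof.
move=> k10; rewrite spcoordLE to_subK ?spmx_in //.
apply/rowP=> i; rewrite !mxE eqxx /spseq /= -(inj_eq val_inj i) /= inordK //.
rewrite !(ent_mx_end e_sympl).
rewrite !(block_mxEul, block_mxEur, block_mxEdl, block_mxEdr) !mxE /=.
by case: i => i /=; each i => _ /=; rewrite ?(addrAC _ _ (- _)) ?subrr ?add0r.
Qed.

(** Six of the sixteen entries are redundant, signs being irrelevant; rewriting with these leaves
    the ten independent ones. *)
Lemma sp_entE (x : L) (E := fun i j => ent e i j (sub_val x)) :
  [/\ E r0 r0 = E l0 l0, E r0 r1 = E l1 l0, E r1 r0 = E l0 l1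
    & E r1 r1 = E l1 l1]
  /\ E l1 r0 = E l0 r1 /\ E r0 l1 = E r1 l0.
Proof.
have /(form_lie_entP e_sympl) xE := sub_val_in x.
have [_ _ E00] := xE 0 0; have [E1 E2 E01] := xE 0 1.
have [_ _ E10] := xE 1 0; have [_ _ E11] := xE 1 1.
by rewrite /E E00 E01 E10 E11 !opp2 E1 E2.
Qed.

Fact spcoord_inj x : spcoordL x = 0 -> x = 0.
Proof.
rewrite spcoordLE => x0.
have x0_ k : (k < 10)%N -> (spseq (sub_val x))`_k = 0.
  by move=> k10; have /rowP/(_ (inord k)) := x0; rewrite !mxE inordK.
rewrite /spseq in x0_.
have /= E11 := x0_ 0 isT; have /= E01 := x0_ 1 isT; have /= E10 := x0_ 2 isT.
have /= Er := x0_ 3 isT; have /= Et := x0_ 4 isT; have /= Ea := x0_ 5 isT.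
have /= Eb1 := x0_ 6 isT; have /= Eb2 := x0_ 7 isT.
have /= Ec1 := x0_ 8 isT; have /= Ec2 := x0_ 9 isT.
have E00 : ent e l0 l0 (sub_val x) = 0.
  by rewrite -[LHS](subrK (ent e l1 l1 (sub_val x))) Ea E11 addr0.
have [[S1 S2 S3 S4] [S5 S6]] := sp_entE x.
apply: sub_val_inj; apply: (ent_inj e_sympl) => i j.
rewrite [RHS](_ : _ = 0); last by rewrite /ent linear0 zero_lfunE linear0.
rewrite -(splitK i) -(splitK j); case: (split i) => i'; case: (split j) => j';
  rewrite /unsplit; move: i' j'; do 2 apply: ord2P;
  by rewrite ?(S1, S2, S3, S4, S5, S6).
Qed.

Fact spcoord_lie (x y : L) k : (k < 10)%N ->
  spcoordL [lie x, y] 0 (inord k) =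
  (sp4_bracket (fun i => spcoordL x 0 (inord i))
               (fun i => spcoordL y 0 (inord i)))`_k.
Proof.
move=> k10; rewrite !spcoordLE sub_val_lie mxE inordK // /sp4_bracket !mxE.
rewrite !inordK // /spseq /=.
rewrite !(ent_lie e_sympl) !big_ord4.
have [[-> -> -> ->] [-> ->]] := sp_entE x.
have [[-> -> -> ->] [-> ->]] := sp_entE y.
move: (sub_val x) (sub_val y) => {x y} x y.
(* The upper left entry is split as a + s before all entries are generalised to independent
   variables. *)
rewrite -[ent e l0 l0 x](subrK (ent e l1 l1 x)).
rewrite -[ent e l0 l0 y](subrK (ent e l1 l1 y)).
rewrite !addrK.
move: (ent e l0 l0 x - ent e l1 l1 x) (ent e l0 l0 y - ent e l1 l1 y) => a a'.
move: (ent e l1 l1 x) (ent e l0 l1 x) (ent e l1 l0 x) (ent e l0 r1 x)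
  (ent e r1 l0 x) (ent e l0 r0 x) (ent e l1 r1 x)
  (ent e r0 l0 x) (ent e r1 l1 x)
  => s p q r t b1 b2 c1 c2.
move: (ent e l1 l1 y) (ent e l0 l1 y) (ent e l1 l0 y) (ent e l0 r1 y)
  (ent e r1 l0 y) (ent e l0 r0 y) (ent e l1 r1 y)
  (ent e r0 l0 y) (ent e r1 l1 y)
  => s' p' q' r' t' b1' b2' c1' c2'.
(* Entry k of the witness collects the terms that occur twice in the commutator, once its minus
   signs are turned into plus, and so vanish. *)
rewrite !opp2; apply: (@eq_char2 _ charF
 [:: s * s'; s * p' + s' * p; q * s' + s * q'; s * r' + s' * r; t * s' + s * t';
     (s + a) * (s' + a') + s * s' + p * q' + p' * q + r * t' + r' * t;
     (s + a) * b1' + p * r' + b1 * (s' + a') + r * p';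
     q * r' + s * b2' + r * q' + b2 * s';
     c1 * (s' + a') + t * q' + (s + a) * c1' + q * t';
     t * p' + c2 * s' + p * t' + s * c2']`_k).
by move: k k10; move=> k; each k => _ /=; ring.
Qed.

Definition sp_coords : sp4_coord L :=
  Sp4Coord spcoord_vec spcoord_inj spcoord_lie.

(** Identifies L^(3), spanned by vector 0, with the scalar operators. *)
Lemma sub_val_spvec0 : sub_val (spvec 0) = \1%VF.
Proof.
rewrite to_subK ?spmx_in //; apply: (ent_inj e_sympl) => i j.
rewrite (ent_mx_end e_sympl) /ent id_lfunE.
rewrite coord_free ?(basis_free (proj1 e_sympl)) //.
rewrite -(splitK i) -(splitK j); case: (split i) => i'; case: (split j) => j';
  rewrite /unsplit; move: i' j'; do 2 apply: ord2P;
  by rewrite !(block_mxEul, block_mxEur, block_mxEdl, block_mxEdr) !mxE /=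
    ?addr0.
Qed.

(** This and the next two lemmas match vectors 5 to 9 with a, b_1, b_2, c_1, c_2 of the
    statement. *)
Lemma spmx5 : spmx (fun i => (i == 5)%N%:R) =
  block_mx (delta_mx 0 0) 0 0 (delta_mx 0 0).
Proof.
by congr block_mx; apply/matrixP; do 2 apply: ord2P; rewrite !mxE /= ?add0r.
Qed.

Lemma spmx6 (i : 'I_2) : spmx (fun j => (j == 6 + i)%N%:R) =
  block_mx 0 (delta_mx i i) 0 0.
Proof.
by move: i; apply: ord2P; congr block_mx; apply/matrixP; do 2 apply: ord2P;
  rewrite !mxE /= ?add0r.
Qed.

Lemma spmx8 (i : 'I_2) : spmx (fun j => (j == 8 + i)%N%:R) =
  block_mx 0 0 (delta_mx i i) 0.
Proof.
by move: i; apply: ord2P; congr block_mx; apply/matrixP; do 2 apply: ord2P;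
  rewrite !mxE /= ?add0r.
Qed.

End Sp4.

(** * Existence of a symplectic basis *)

Section SymplecticBasisExists.
Variables (F : fieldType) (V : vectType F) (f : {biscalar V}).
Hypothesis f_alt : alternating_form f.
Hypothesis f_nondeg : nondegenerate_form f.

Lemma alternating_skew v w : f v w = - f w v.
Proof.
apply/eqP; rewrite -addr_eq0; apply/eqP.
by have := f_alt (v + w); rewrite linearDl !linearDr /= !f_alt add0r addr0.
Qed.

Lemma nondegenerate_pair u : u != 0 -> exists w, f u w = 1.
Proof.
move=> u0; have /existsNP[w /eqP fuw] : ~ forall w, f u w = 0.
  by move/f_nondeg/eqP; rewrite (negPf u0).
by exists ((f u w)^-1 *: w); rewrite linearZr /= mulVf.
Qed.

(** A hyperbolic pair is chosen, and a second one is found in its orthogonal complement. *)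
Lemma symplectic_basis_exists : \dim {:V} = 4%N ->
  exists e : (2 + 2).-tuple V, symplectic_basis f e.
Proof.
move=> dimV; have u0 : vpick {:V} != 0 by rewrite vpick0 -dimv_eq0 dimV.
move: (vpick _) u0 => u u0; have [w fuw] := nondegenerate_pair u0.
have fwu : f w u = - 1 by rewrite alternating_skew fuw.
(* The component of v orthogonal to u and w, since f u w = 1. *)
pose p v := v - f u v *: w - f v w *: u.
have fup v : f u (p v) = 0.
  by rewrite !linearBr !linearZr /= fuw f_alt mulr1 mulr0 subr0 subrr.
have fwp v : f w (p v) = 0.
  rewrite !linearBr !linearZr /= f_alt fwu mulr0 subr0 mulrN1 opprK.
  by rewrite (alternating_skew v w) subrr.
(* In dimension 4 some v lies outside the plane of u and w, so that [p v] is nonzero. *)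
have /subvPn[v _ vNuw] : ~~ (fullv <= <<[:: u; w]>>)%VS.
  apply: contraL (dim_span [:: u; w]) => /dimvS; rewrite dimV -ltnNge.
  exact: leq_trans.
have v0 : p v != 0.
  apply: contraNneq vNuw => /eqP; rewrite /p -addrA -opprD subr_eq0 => /eqP ->.
  by rewrite rpredD // memvZ // memv_span // !inE eqxx ?orbT.
have [w' fvw] := nondegenerate_pair v0.
have fvw2 : f (p v) (p w') = 1.
  rewrite {2}/p !linearBr !linearZr /= fvw (alternating_skew _ w) fwp.
  by rewrite (alternating_skew _ u) fup oppr0 !mulr0 !subr0.
pose e : (2 + 2).-tuple V := [tuple u; p v; w; p w'].
have gram (i j : 'I_(2 + 2)) : f e`_i e`_j = symplectic_mx F 2 i j.
  rewrite -(splitK i) -(splitK j); case: (split i) => i'; case: (split j) => j';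
  rewrite /unsplit; move: i' j'; do 2 apply: ord2P;
  rewrite !(block_mxEul, block_mxEur, block_mxEdl, block_mxEdr) !mxE /=;
  rewrite ?f_alt ?fuw ?fwu ?fup ?fwp ?fvw2 ?oppr0 //.
  1-5: by rewrite alternating_skew ?fup ?fwp ?fvw2 ?oppr0.
exists e; split=> //.
rewrite basisEfree subvf dimV size_tuple leqnn !andbT.
apply/freeP => k k0.
(* Pairing a linear relation with each basis vector gives k J = 0, and each column of J isolates one
   coefficient up to sign. *)
have kJ j : \sum_i k i * symplectic_mx F 2 i j = 0.
  have := congr1 (f ^~ e`_j) k0; rewrite linear_sumlz linear0l => E.
  by rewrite -[RHS]E; apply: eq_bigr => i _; rewrite linearZl_LR /= gram.
move=> i; rewrite -(splitK i); case: (split i) => j; rewrite /unsplit.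
  have := kJ (rshift 2 j); rewrite big_ord4 /symplectic_mx; move: j.
  by apply: ord2P; rewrite !(block_mxEur, block_mxEdr) !mxE /=
    !(mulr0, mulr1, addr0, add0r).
have := kJ (lshift 2 j); rewrite big_ord4 /symplectic_mx; move: j.
by apply: ord2P; rewrite !(block_mxEul, block_mxEdl) !mxE /= ?oppr0
    !(mulr0, mulrN1, addr0, add0r) => /eqP; rewrite oppr_eq0 => /eqP.
Qed.

End SymplecticBasisExists.

(** * The module U = L^(2) / L^(3) *)

Section SectionModule.
Variables (F : fieldType) (g : lieAlgType F) (c : sp4_coord g).
Local Notation X := (vec c).
Local Notation cd := (cd c).
Local Notation D k := (derived g k).
Local Notation U := (lie_section (D 2) (D 3)).
Local Notation R := (section_rep (D 2) (D 3)).
Local Notation pr := (sec_proj (D 2) (D 3)).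

Lemma mem_derived2 x : (x \in D 2) = (x \in flag c 5).
Proof. by rewrite -(derived2 c). Qed.

Lemma mem_derived3 x : (x \in D 3) = (x \in flag c 1).
Proof. by rewrite -(derived3 c). Qed.

Lemma memX2 i : (i < 5)%N -> X i \in D 2.
Proof. by move=> i5; rewrite mem_derived2 memX. Qed.

(** Shifted by one because coordinate 0 of L spans L^(3); by [scE] the choice of representative is
    immaterial. *)
Definition sc (k : nat) (u : U) : F := cd k.+1 (sec_repr u).

Lemma scE k x : (k < 4)%N -> x \in D 2 -> sc k (pr x) = cd k.+1 x.
Proof.
move=> k4 x2; apply/eqP; rewrite /sc -subr_eq0 -cdN -cdD; apply/eqP.
suff /flagP-/(_ isT)/(_ k.+1) : sec_repr (pr x) - x \in flag c 1.
  by apply; apply: (leq_ltn_trans k4).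
by rewrite -mem_derived3 -(sec_proj_eq (I := D 2)) ?sec_repr_in // sec_reprK.
Qed.

Lemma scD k u w : (k < 4)%N -> sc k (u + w) = sc k u + sc k w.
Proof.
move=> k4; rewrite -[u]sec_reprK -[w]sec_reprK.
by rewrite -sec_projD !scE ?rpredD ?sec_repr_in // cdD.
Qed.

Lemma scZ k a u : (k < 4)%N -> sc k (a *: u) = a * sc k u.
Proof.
move=> k4; rewrite -[u]sec_reprK.
by rewrite -sec_projZ !scE ?rpredZ ?sec_repr_in // cdZ.
Qed.

Lemma sc_inj u w : (forall k, (k < 4)%N -> sc k u = sc k w) -> u = w.
Proof.
move=> uw; rewrite -[u]sec_reprK -[w]sec_reprK.
have ru := sec_repr_in u; have rw := sec_repr_in w.
apply/eqP; rewrite sec_proj_eq // mem_derived3; apply/flagP => // -[|k] //= k10.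
rewrite cdD cdN; apply/eqP; rewrite subr_eq0; apply/eqP.
have [/uw // | k4] := ltnP k 4.
move: ru rw; rewrite !mem_derived2 => /flagP-/(_ isT) ru /flagP-/(_ isT) rw.
by rewrite ru ?rw // ltnS k4.
Qed.

Lemma sc_vec k j : (k < 4)%N -> (j < 4)%N -> sc k (pr (X j.+1)) = (k == j)%:R.
Proof.
move=> k4 j4; rewrite scE ?memX2 // cdX //; first exact: (leq_ltn_trans k4).
exact: (leq_ltn_trans j4).
Qed.

(** [rep4_act] is entries 1 to 4 of the bracket once coordinates 5 to 9 of the second argument are
    set to zero. *)
Lemma sc_rep k x u : (k < 4)%N ->
  sc k (R x u) = (rep4_act (cd^~ x) (sc^~ u))`_k.
Proof.
move=> k4; rewrite -[u]sec_reprK; have u2 := sec_repr_in u.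
rewrite section_rep_proj // scE ?ideal_closed //.
rewrite cd_lie; last exact: (leq_ltn_trans k4).
move: (sec_repr u) u2 => y y2.
have := y2; rewrite mem_derived2 => /flagP-/(_ isT) y0.
move: k4; each k => _; rewrite /= !scE //.
all: by rewrite !(y0 5, y0 6, y0 7, y0 8, y0 9) //; ring.
Qed.

Definition sec_coord : rep4_coord c R :=
  @Rep4Coord _ _ _ c R sc (fun j => pr (X j.+1)) scD scZ sc_inj sc_vec sc_rep.

(** Rank and nullity for [pr] on L^(2): 5 - 1. *)
Lemma dim_section : \dim {:U} = 4%N.
Proof.
have := limg_ker_dim (linfun pr) (D 2).
rewrite (_ : (D 2 :&: _)%VS = D 3); last first.
  apply/vspaceP=> x; rewrite memv_cap memv_ker lfunE /=.
  case x2: (x \in D 2); first by rewrite sec_proj_eq0.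
  apply/esym/negbTE; move: x2; rewrite mem_derived2 mem_derived3 => /negbT.
  apply: contra.
  move=> /flagP-/(_ isT) x0; apply/flagP=> // k /andP[k5 k10].
  by rewrite x0 // k10 (leq_trans _ k5).
rewrite (derived2 c) (derived3 c) !dim_flag //.
rewrite (_ : (_ @: _)%VS = fullv) => [[] //|].
apply/vspaceP=> u; rewrite memvf -(derived2 c).
apply/memv_imgP; exists (sec_repr u).
  exact: sec_repr_in.
by rewrite lfunE /= sec_reprK.
Qed.

(** Brackets of elements of L^(2) lie in L^(3) by definition. *)
Lemma section_abelian : lie_abelian U.
Proof.
move=> u w; rewrite -[u]sec_reprK -[w]sec_reprK.
have u2 := sec_repr_in u; have w2 := sec_repr_in w.
rewrite sec_proj_lie //; apply/eqP.
rewrite sec_proj_eq0; last exact: ideal_closed.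
by have := memv_lie u2 w2.
Qed.

End SectionModule.

Theorem proposition12p4 (F : fieldType) (V : vectType F) (f : {biscalar V})
    (charF : 2%N \in [pchar F]) (dimV : \dim {:V} = 4%N)
    (f_alt : alternating_form f) (f_nondeg : nondegenerate_form f) :
  let L : lieAlgType F := lie_sub (form_lie f) in
  let D (k : nat) : lieIdeal L := derived L k in
  let Q : lieAlgType F := lie_quot (D 2%N) in
  let U : lieAlgType F := lie_section (D 2%N) (D 3%N) in
  let R : 'Hom(L, 'End(U)) := section_rep (D 2%N) (D 3%N) in
  [/\ \dim {:L} = 10%N, \dim (D 1%N) = 6%N, \dim (D 2%N) = 5%N,
      \dim (D 3%N) = 1%N & \dim (D 4%N) = 0%N]
  /\ (sub_incl (form_lie f) @: D 3%N)%VS = <[\1%VF]>%VS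
  /\ lie_isomorphic (lie_sub (D 2%N)) (heisenberg F 2)
  /\ lie_isomorphic (heisenberg F 2) Q
  /\ [/\ \dim {:U} = 4%N, lie_abelian U, lie_hom R & irreducible_rep R]
  /\ exists (g : {biscalar U}) (S : 'Hom(Q, 'End(U))),
       [/\ alternating_form g, nondegenerate_form g,
           forall x u w, g (R x u) w + g u (R x w) = 0,
           (limg R <= form_lie g)%VS
         & lker R = D 2%N]
       /\ [/\ lie_hom S, forall x, S (lie_proj (D 2%N) x) = R x,
              lker S = 0%VS & irreducible_rep S]
       /\ (exists M : lieSubalg 'End(U),
             [/\ M = limg S :> {vspace 'End(U)},
                 M = limg R :> {vspace 'End(U)},
                 \dim M = 5%N,
                 (M <= form_lie g)%VS
               & irreducible_rep (sub_incl M)])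
       /\ (exists e : (2 + 2).-tuple V, symplectic_basis f e)
       /\ forall e : (2 + 2).-tuple V, symplectic_basis f e ->
            let E (i : 'I_2) : 'M[F]_2 := delta_mx i i in
            let a : 'End(V) := mx_end e (block_mx (E 0) 0 0 (E 0)) in
            let b i : 'End(V) := mx_end e (block_mx 0 (E i) 0 0) in
            let c i : 'End(V) := mx_end e (block_mx 0 0 (E i) 0) in
            let cl (x : 'End(V)) : Q :=
              lie_proj (D 2%N) (to_sub (form_lie f) x) in
            [/\ a \in form_lie f, forall i, b i \in form_lie f
              & forall i, c i \in form_lie f]
            /\ exists theta : 'Hom(heisenberg F 2, Q),
                 [/\ lie_iso theta,
                     forall i, theta (heis_u i) = cl (b i),
                     forall i, theta (heis_v i) = cl (c i),
                     theta heis_z = cl a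
                   & module_isomorphic
                       (fun (x : heisenberg F 2) (u : U) => S (theta x) u)
                       (@trunc_act F 2)].
Proof.
move=> L D Q U R.
have [e e_s] := symplectic_basis_exists f_alt f_nondeg dimV.
pose c : sp4_coord L := sp_coords charF e_s.
pose d := sec_coord c.
have D2 : D 2 = flag c 5 :> {vspace L} by exact: derived2.
have D3 : D 3 = flag c 1 :> {vspace L} by exact: derived3.
pose pi := quot_pi (D 2).
have pi_hom : lie_hom pi by exact: quot_pi_hom.
have pi_surj q : exists x, pi x = q by exact: quot_pi_surj.
(* Stated for all coordinate systems: S is built from [c], but h(2) must be identified relative to
   every symplectic basis. *)
have pi_ker (c' : sp4_coord L) : lker pi = flag c' 5.
  by rewrite /pi quot_pi_ker; exact: derived2.
have R_hom : lie_hom R by exact: section_rep_hom.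
have [S S_pi] := rep_factor (pi_ker c) d.
have thP (c' : sp4_coord L) : lie_iso (htheta c' pi).
  exact: htheta_iso.
split.
  split.
  - by rewrite -(flag10 c) dim_flag.
  - by rewrite /D (derived1 c) dim_flag.
  - by rewrite D2 dim_flag.
  - by rewrite D3 dim_flag.
  - by rewrite /D (derived4 c) dim_flag.
split.
  rewrite D3 /flag span_seq1 limg_line; congr <[_]>%VS.
  by rewrite lfunE; exact: sub_val_spvec0.
split.
  exists (linfun (hcoord c) \o sub_incl (D 2))%VF.
  apply: (hcoord_iso (ret := to_sub (D 2))) => //.
  - exact: sub_incl_hom.
  - by move=> y; rewrite lfunE -D2 /=; apply: sub_val_in.
  - by move=> x; rewrite -D2 lfunE => x2; apply: to_subK.
  - by move=> x y; rewrite !lfunE; apply: sub_val_inj.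
split; first by exists (htheta c pi).
split.
  split=> //.
  - exact: (dim_section c).
  - exact: section_abelian.
  - exact: (rep4_irreducible d).
exists (uform d), S.
split.
  split.
  - exact: uform_alt.
  - exact: uform_nondeg.
  - exact: uform_inv.
  - exact: limg_rep_form.
  - rewrite D2; exact: (lker_rep4 d).
split.
  split.
  - exact: factor_hom.
  - by move=> x; rewrite -[lie_proj _ _]quot_piE; exact: S_pi.
  - exact: (factor_ker pi_surj (pi_ker c) d).
  - exact: (factor_irreducible d S_pi).
split.
  exists (limg_rep R_hom); split=> //.
  - by rewrite (factor_limg pi_surj S_pi).
  - exact: (dim_limg_rep d).
  - exact: limg_rep_form.
  - exact: (limg_rep_irreducible d).
split; first by exists e.
move=> e' e's E a b b' cl.
(* Coordinates of the given basis; [S_pi] mentions no basis, so the same S serves. *)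
pose c' : sp4_coord L := sp_coords charF e's.
split.
  split=> [|i|i].
  - by rewrite /a -spmx5 (spmx_in charF).
  - by rewrite /b -spmx6 (spmx_in charF).
  - by rewrite /b' -spmx8 (spmx_in charF).
exists (htheta c' pi); split=> [|i|i||].
- exact: thP.
- by rewrite htheta_u quot_piE /cl /b -spmx6.
- by rewrite htheta_v quot_piE /cl /b' -spmx8.
- by rewrite htheta_z quot_piE /cl /a -spmx5.
- exact: (trunc_module_iso (sec_coord c') charF S_pi).
Qed.
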